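(* Under the model and assumptions listed in the context, for any node $i\in\mathcal N$ and any time-slot $k$, $$|b_{i,k}|\le \frac{\alpha_G\,\alpha_\Phi^3}{2\sigma_\Phi^2}\,w_{i,k},\qquad w_{i,k}=\frac{q_a}{\overline{\beta\gamma}_k}\sum_{j_1,j_2\in\mathcal N}\mathbb E\big(\widetilde\beta_{i,k}\,\widetilde\gamma_{j_1,k}\,\widetilde\gamma_{j_2,k}\big).$$ Furthermore $w_{i,k}\to 0$ as $k\to\infty$; thus $|b_{i,k}|\to 0$.
   Context: Model. There are $N$ nodes, $\mathcal N=\{1,\dots,N\}$, and time-slots $k=1,2,\dots$. The indicator $\delta_{i,k}\in\{0,1\}$ tells whether node $i$ is active at slot $k$; the $\delta_{i,k}$ are i.i.d. with $\mathbb P(\delta_{i,k}=1)=q_a\in(0,1]$, and $\lambda=Nq_a<\infty$. The number of active nodes is binomial with mean $\lambda$ (if $N\to\infty$, $q_a$ is small so that $\lambda<\infty$ and the number is Poisson with parameter $\lambda$). Put $\boldsymbol\delta_k=(\delta_{1,k},\dots,\delta_{N,k})^T$ and $\mathcal N^{(k)}=\{i:\delta_{i,k}=1\}$. Actions take values in $\mathcal A_i=[a_{i,\min},a_{i,\max}]$; $\mathcal A=\mathcal A_1\times\cdots\times\mathcal A_N$. The environment states $\mathbf S_k\in\mathcal S$ are i.i.d. random matrices. The symbol $\circ$ is the element-wise product and $\|\cdot\|$ the Euclidean norm. Utilities. Each node has a real local utility function $u_i(\boldsymbol a,\boldsymbol\delta,\mathbf S)$ of the action vector $\boldsymbol a$,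 the activity vector $\boldsymbol\delta\in\{0,1\}^N$ and the environment state $\mathbf S\in\mathcal S$, with $u_i=0$ if $\delta_i=0$. Put $f=\sum_{i:\delta_i=1}u_i$, $G(\boldsymbol a,\boldsymbol\delta)=\mathbb E_{\mathbf S}f(\boldsymbol a,\boldsymbol\delta,\mathbf S)$, $F(\boldsymbol a)=\mathbb E_{\boldsymbol\delta,\mathbf S}f(\boldsymbol a,\boldsymbol\delta,\mathbf S)$. Observations. At slot $k$, if $\widehat{\boldsymbol a}$ is the performed action vector, active node $i$ observes $\widetilde u_{i,k}=u_i(\widehat{\boldsymbol a},\boldsymbol\delta_k,\mathbf S_k)+\eta_{i,k}$, where the noises $\eta_{i,k}$ are independent with mean $0$ and variance $\sigma_\eta^2<\infty$. Active node $i$ receives $\widetilde u_{j,k}$ for $j$ in a random set $\mathcal I^{(i,k)}\subseteq\mathcal N^{(k)}\setminus\{i\}$; each $j\in\mathcal N^{(k)}\setminus\{i\}$ belongs to it with constant probability $q_r\in(0,1]$ (the joint probability that $j$ is a neighbor of $i$ and that the transmission succeeds), independently over $j$. Node $i$ computes $\widetilde f_{i,k}=\widetilde u_{i,k}+q_r^{-1}\sum_{j\in\mathcal I^{(i,k)}}\widetilde u_{j,k}$. Regularity. (a) $G(\boldsymbol a,\boldsymbol\delta)$ and $F(\boldsymbol a)$ are first and second order differentiable functions of $\boldsymbol a\in\mathcal A$; the optimal point $\boldsymbol a^*\in\mathcal A$ (maximizer of $F$ over $\mathcal A$) exists, with $\partial F(\boldsymbol a^* )/\partial a_i=0$, $\partial^2F(\boldsymbol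 a^* )/\partial a_i^2<0$ and $a_i^*\in(a_{i,\min},a_{i,\max})$ for all $i$; and $F$ is strictly concave: $(\boldsymbol a-\boldsymbol a')^T(\nabla F(\boldsymbol a)-\nabla F(\boldsymbol a'))<0$ for all $\boldsymbol a\ne\boldsymbol a'$ in $\mathcal A$. (b) There is $\alpha_G\in(0,\infty)$ with $|\partial^2G(\boldsymbol a,\boldsymbol\delta)/\partial a_i\partial a_j|\le\alpha_G$ for all active $i,j$ ($\delta_i=\delta_j=1$). (c) For any $\boldsymbol\delta,\mathbf S$, $|u_i(\boldsymbol a,\boldsymbol\delta,\mathbf S)-u_i(\boldsymbol a',\boldsymbol\delta,\mathbf S)|\le L_{\mathbf S}\|(\boldsymbol a-\boldsymbol a')\circ\boldsymbol\delta\|$ with $L_{\mathbf S}<\infty$ and $L=\sqrt{\mathbb E(L_{\mathbf S}^2)}<\infty$. Parameters. $\beta_\ell=\beta_0\ell^{-c_1}$, $\gamma_\ell=\gamma_0\ell^{-c_2}$ for $\ell\ge1$, with $\beta_0,\gamma_0>0$, $c_1\in(0.5,1)$, $c_2\in(0,1-c_1]$ (so $\sum\beta_\ell\gamma_\ell=\infty$, $\sum\beta_\ell^2<\infty$). The perturbations $\Phi_{i,k}$ are i.i.d., mean zero, with $\mathbb E(\Phi_{i,k}^2)=\sigma_\Phi^2$, $\sigma_\Phi>0$, and $|\Phi_{i,k}|\le\alpha_\Phi$, $\alpha_\Phi>0$. There is $K_0<\infty$ with $\alpha_\Phi\gamma_\ell\le\min_{i}\min\{|a_{i,\max}-a_i^*|,|a_{i,\min}-a_i^*|\}$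 for all $\ell\ge K_0$. Random step-sizes. $\widetilde\ell_{i,k}\sim\mathrm{Binomial}(k-1,q_a)$, generated independently by each node; $\ell_{i,k}=\widetilde\ell_{i,k}+\delta_{i,k}$, $\widetilde\beta_{i,k}=\delta_{i,k}\beta_{\ell_{i,k}}$, $\widetilde\gamma_{i,k}=\delta_{i,k}\gamma_{\ell_{i,k}}$ (both $0$ if $\delta_{i,k}=0$). The variables $\widetilde\ell$, $\Phi$, $\eta$, $\mathbf S$, $\delta$ and the receptions are mutually independent, and independent across time-slots. DOSP-S algorithm. $a_{i,1}$ is chosen randomly in $[a_{i,\min}+\alpha_\Phi\widetilde\gamma_{i,1},a_{i,\max}-\alpha_\Phi\widetilde\gamma_{i,1}]$. At slot $k$ the performed action is $\boldsymbol a_k+\widetilde{\boldsymbol\gamma}_k\circ\boldsymbol\Phi_k$, $\widetilde f_{i,k}$ is computed from the resulting observations, and for every $i$ $$\widetilde a_{i,k+1}=a_{i,k}+\widetilde\beta_{i,k}\Phi_{i,k}\widetilde f_{i,k},\qquad a_{i,k+1}=\min\{\max\{\widetilde a_{i,k+1},\,a_{i,\min}+\alpha_\Phi\widetilde\gamma_{i,k+1}\},\,a_{i,\max}-\alpha_\Phi\widetilde\gamma_{i,k+1}\}.$$ The projection is applied to ensure that the performed actions belong to $\mathcal A$. Bias. Let $\widehat g_{i,k}=\widetilde\beta_{i,k}\Phi_{i,k}\widetilde f_{i,k}$ and let $\overline g_{i,k}$ be the expectation of $\widehat g_{i,k}$ with respect to $(\mathbf S_k,\boldsymbol\eta_k,\mathcal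 I^{(i,k)},\boldsymbol\Phi_k,\boldsymbol\delta_k,\boldsymbol\ell_k)$, conditioned by any $\boldsymbol a_k\in\mathcal A$. Put $\overline{\beta\gamma}_k=\mathbb E(\widetilde\beta_{i,k}\widetilde\gamma_{i,k})$ (the same for every $i$) and $$b_{i,k}=\frac{q_a}{\sigma_\Phi^2\,\overline{\beta\gamma}_k}\,\overline g_{i,k}-\frac{\partial F}{\partial a_i}(\boldsymbol a_k).$$
   Formalization: The bound on b and its limit are claimed only for actions a_k such that every possible performed action stays in a box containing A (possibly A itself) on which the utilities satisfy the regularity assumptions; without this the claim can fail or be undefined near the boundary of A. *)

(* Defs.v *)
From HB Require Import structures.
From mathcomp Require Import all_boot all_order all_algebra.
From mathcomp Require Import all_classical all_reals all_analysis.
Set Implicit Arguments.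
Unset Strict Implicit.
Unset Printing Implicit Defensive.
Import Order.TTheory GRing.Theory Num.Theory numFieldNormedType.Exports.
Local Open Scope classical_set_scope.
Local Open Scope ring_scope.

Definition mutually_independent (d : measure_display) (T : measurableType d)
    (R : realType) (P : probability T R) (I : eqType)
    (F : I -> set (set T)) : Prop :=
  forall s : seq I, uniq s -> forall A : I -> set T,
    (forall i, i \in s -> F i (A i)) ->
    P (\bigcap_(i in [set` s]) A i) = (\prod_(i <- s) fine (P (A i)))%:E.

Definition box (R : realType) (N : nat) (lo hi : 'rV[R]_N) : set 'rV[R]_N :=
  [set a | forall i, lo 0 i <= a 0 i <= hi 0 i].

Definition partial (R : realType) (N : nat) (i : 'I_N) (g : 'rV[R]_N -> R) :
  'rV[R]_N -> R := fun a => 'D_(delta_mx 0 i) g a.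

Definition twice_differentiable_on (R : realType) (N : nat)
    (D : set 'rV[R]_N) (g : 'rV[R]_N -> R) : Prop :=
  forall a, D a ->
    differentiable g a /\ forall i, differentiable (partial i g) a.

(* The norm on 'rV[R]_N in the library is the sup norm. *)
Definition euclidean_norm (R : realType) (N : nat) (v : 'rV[R]_N) : R :=
  Num.sqrt (\sum_i v 0 i ^+ 2).

Definition mask (R : realType) (N : nat) (d : {ffun 'I_N -> bool})
  (v : 'rV[R]_N) : 'rV[R]_N := \row_i (v 0 i * (d i)%:R).

(* Slots are numbered from 1: the values of the random variables at k = 0 play
   no role.  The utilities are total functions of the action vector, but they
   are only assumed to be regular on [box dmin dmax], which contains the action
   set [box amin amax] and may be equal to it. *)
Record dosp_model (R : realType) (N : nat) := DospModel {
  dispO : measure_display;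
  Omega : measurableType dispO;
  Pr : probability Omega R;
  dispS : measure_display;
  St : measurableType dispS;
  delta : 'I_N -> nat -> Omega -> bool;
  elltilde : 'I_N -> nat -> Omega -> nat;
  Phi : 'I_N -> nat -> Omega -> R;
  eta : 'I_N -> nat -> Omega -> R;
  env : nat -> Omega -> St;
  (* [link k w (i, j)]: if j is active at slot k, then i receives from j *)
  link : nat -> Omega -> {ffun 'I_N * 'I_N -> bool};
  u : 'I_N -> 'rV[R]_N -> {ffun 'I_N -> bool} -> St -> R;
  lipS : St -> R;
  amin : 'rV[R]_N;
  amax : 'rV[R]_N;
  dmin : 'rV[R]_N;
  dmax : 'rV[R]_N;
  astar : 'rV[R]_N;
  qa : R;
  qr : R;
  sigma_eta : R;
  sigma_Phi : R;
  alpha_Phi : R;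
  alpha_G : R;
  beta0 : R;
  gamma0 : R;
  c1 : R;
  c2 : R
}.

Definition beta (R : realType) (N : nat) (M : dosp_model R N) (l : nat) : R :=
  beta0 M * l%:R `^ (- c1 M).

Definition gamma (R : realType) (N : nat) (M : dosp_model R N) (l : nat) : R :=
  gamma0 M * l%:R `^ (- c2 M).

Definition ell (R : realType) (N : nat) (M : dosp_model R N) (i : 'I_N)
  (k : nat) (w : Omega M) : nat := (elltilde i k w + delta i k w)%N.

Definition betatilde (R : realType) (N : nat) (M : dosp_model R N) (i : 'I_N)
  (k : nat) (w : Omega M) : R := (delta i k w)%:R * beta M (ell i k w).

Definition gammatilde (R : realType) (N : nat) (M : dosp_model R N) (i : 'I_N)
  (k : nat) (w : Omega M) : R := (delta i k w)%:R * gamma M (ell i k w).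

Definition activity (R : realType) (N : nat) (M : dosp_model R N) (k : nat)
  (w : Omega M) : {ffun 'I_N -> bool} := [ffun i => delta i k w].

Definition utot (R : realType) (N : nat) (M : dosp_model R N) (a : 'rV[R]_N)
    (d : {ffun 'I_N -> bool}) (s : St M) : R :=
  \sum_(i | d i) u i a d s.

(* The laws of env and of the activity vector do not depend on the slot, so G and
   F may be computed at slot 1. *)
Definition G (R : realType) (N : nat) (M : dosp_model R N)
    (d : {ffun 'I_N -> bool}) (a : 'rV[R]_N) : R :=
  fine 'E_(Pr M)[fun w => utot a d (env 1 w)].

Definition F (R : realType) (N : nat) (M : dosp_model R N)
    (a : 'rV[R]_N) : R :=
  fine 'E_(Pr M)[fun w => utot a (activity 1 w) (env 1 w)].

Definition performed (R : realType) (N : nat) (M : dosp_model R N) (k : nat)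
    (a : 'rV[R]_N) (w : Omega M) : 'rV[R]_N :=
  a + \row_j (gammatilde j k w * Phi j k w).

Definition utilde (R : realType) (N : nat) (M : dosp_model R N) (i : 'I_N)
    (k : nat) (a : 'rV[R]_N) (w : Omega M) : R :=
  u i (performed k a w) (activity k w) (env k w) + eta i k w.

Definition received (R : realType) (N : nat) (M : dosp_model R N) (i : 'I_N)
    (k : nat) (w : Omega M) : {set 'I_N} :=
  finset (fun j => [&& j != i, delta j k w & link k w (i, j)]).

Definition ftilde (R : realType) (N : nat) (M : dosp_model R N) (i : 'I_N)
    (k : nat) (a : 'rV[R]_N) (w : Omega M) : R :=
  utilde i k a w + (qr M)^-1 * \sum_(j in received i k w) utilde j k a w.

Definition ghat (R : realType) (N : nat) (M : dosp_model R N) (i : 'I_N)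
    (k : nat) (a : 'rV[R]_N) (w : Omega M) : R :=
  betatilde i k w * Phi i k w * ftilde i k a w.

(* The action vector a_k is frozen at the value a; everything else that occurs
   in ghat is averaged. *)
Definition gbar (R : realType) (N : nat) (M : dosp_model R N) (i : 'I_N)
  (k : nat) (a : 'rV[R]_N) : R := fine 'E_(Pr M)[ghat i k a].

Definition betagamma (R : realType) (N : nat) (M : dosp_model R N) (i : 'I_N)
    (k : nat) : R :=
  fine 'E_(Pr M)[fun w => betatilde i k w * gammatilde i k w].

Definition bias (R : realType) (N : nat) (M : dosp_model R N) (i : 'I_N)
    (k : nat) (a : 'rV[R]_N) : R :=
  qa M / (sigma_Phi M ^+ 2 * betagamma M i k) * gbar M i k a
    - partial i (F M) a.

Definition weight (R : realType) (N : nat) (M : dosp_model R N) (i : 'I_N)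
    (k : nat) : R :=
  qa M / betagamma M i k *
    \sum_(j1 < N) \sum_(j2 < N)
      fine 'E_(Pr M)[fun w => betatilde i k w * gammatilde j1 k w
                              * gammatilde j2 k w].

(* Every realization of the performed action stays where the utilities are
   regular, so that the average defining [gbar M i k a] makes sense. *)
Definition performable (R : realType) (N : nat) (M : dosp_model R N) (k : nat)
    (a : 'rV[R]_N) : Prop :=
  forall w : Omega M, box (dmin M) (dmax M) (performed k a w).

Inductive source (N : nat) : Type :=
  | Activity of 'I_N | Step of 'I_N | Perturbation of 'I_N | Noise of 'I_N
  | Environment | Reception.

HB.instance Definition _ (N : nat) := gen_eqMixin (source N).

(* Sigma-algebra generated by a source at slot k.  The links of a slot form one
   source, as no independence between different receivers is assumed. *)
Definition source_events (R : realType) (N : nat) (M : dosp_model R N)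
    (k : nat) (x : source N) : set (set (Omega M)) :=
  match x with
  | Activity i => preimage_set_system setT (delta i k) measurable
  | Step i => preimage_set_system setT (elltilde i k) measurable
  | Perturbation i => preimage_set_system setT (Phi i k) measurable
  | Noise i => preimage_set_system setT (eta i k) measurable
  | Environment => preimage_set_system setT (env k) measurable
  | Reception => preimage_set_system setT (link k) setT
  end.

Arguments source_events {R N} M k x.

Record random_sources (R : realType) (N : nat) (M : dosp_model R N) : Prop :=
  RandomSources {
  qa_range : 0 < qa M <= 1;
  qr_range : 0 < qr M <= 1;
  sigma_Phi_gt0 : 0 < sigma_Phi M;
  alpha_Phi_gt0 : 0 < alpha_Phi M;
  delta_meas : forall i k, (0 < k)%N -> measurable_fun setT (@delta R N M i k);
  elltilde_meas : forall i k, (0 < k)%N ->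
    measurable_fun setT (@elltilde R N M i k);
  Phi_meas : forall i k, (0 < k)%N -> measurable_fun setT (@Phi R N M i k);
  eta_meas : forall i k, (0 < k)%N -> measurable_fun setT (@eta R N M i k);
  env_meas : forall k, (0 < k)%N -> measurable_fun setT (@env R N M k);
  link_meas : forall k B, (0 < k)%N -> measurable (@link R N M k @^-1` B);
  delta_law : forall i k, (0 < k)%N ->
    Pr M [set w | delta i k w] = (qa M)%:E;
  elltilde_law : forall i k m, (0 < k)%N ->
    Pr M [set w | elltilde i k w = m] = (binomial_pmf k.-1 (qa M) m)%:E;
  Phi_law : forall i j k l B, (0 < k)%N -> (0 < l)%N -> measurable B ->
    Pr M (Phi i k @^-1` B) = Pr M (Phi j l @^-1` B);
  Phi_mean : forall i k, (0 < k)%N -> ('E_(Pr M)[@Phi R N M i k] = 0)%E;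
  Phi_second_moment : forall i k, (0 < k)%N ->
    ('E_(Pr M)[fun w => (Phi i k w ^+ 2)%R] = (sigma_Phi M ^+ 2)%:E)%E;
  Phi_bound : forall i k w, (0 < k)%N -> `|@Phi R N M i k w| <= alpha_Phi M;
  eta_mean : forall i k, (0 < k)%N -> ('E_(Pr M)[@eta R N M i k] = 0)%E;
  eta_variance : forall i k, (0 < k)%N ->
    ('V_(Pr M)[@eta R N M i k] = (sigma_eta M ^+ 2)%:E)%E;
  env_law : forall k B, (0 < k)%N -> measurable B ->
    Pr M (env k @^-1` B) = Pr M (env 1 @^-1` B);
  link_law : forall i j k, (0 < k)%N -> j != i ->
    Pr M [set w | link k w (i, j)] = (qr M)%:E;
  link_indep : forall i k, (0 < k)%N ->
    mutually_independent (Pr M) (fun j : {j : 'I_N | j != i} =>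
      preimage_set_system setT
        (fun w => link k w (i, val j)) (@measurable _ bool));
  (* the index (x, k) stands for the source x at slot k.+1 *)
  sources_indep : mutually_independent (Pr M)
    (fun xk : source N * nat => source_events M xk.2.+1 xk.1)
}.

Record regular_utilities (R : realType) (N : nat) (M : dosp_model R N) : Prop :=
  RegularUtilities {
  box_sub : box (amin M) (amax M) `<=` box (dmin M) (dmax M);
  u_meas : forall i a d, box (dmin M) (dmax M) a ->
    measurable_fun setT (@u R N M i a d);
  u_integrable : forall i a d, box (dmin M) (dmax M) a ->
    (Pr M).-integrable setT (fun w => (u i a d (env 1 w))%:E);
  u_inactive : forall i a (d : {ffun 'I_N -> bool}) s,
    box (dmin M) (dmax M) a -> ~~ d i -> @u R N M i a d s = 0;
  G_twice_diff : forall d,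
    twice_differentiable_on (box (dmin M) (dmax M)) (G M d);
  F_twice_diff : twice_differentiable_on (box (dmin M) (dmax M)) (F M);
  astar_interior : forall i, amin M 0 i < astar M 0 i < amax M 0 i;
  astar_max : forall a, box (amin M) (amax M) a -> F M a <= F M (astar M);
  astar_critical : forall i, partial i (F M) (astar M) = 0;
  astar_second : forall i, partial i (partial i (F M)) (astar M) < 0;
  F_strictly_concave : forall a a',
    box (amin M) (amax M) a -> box (amin M) (amax M) a' -> a <> a' ->
    \sum_i (a 0 i - a' 0 i) * (partial i (F M) a - partial i (F M) a') < 0;
  alpha_G_gt0 : 0 < alpha_G M;
  G_hessian_bound : forall (d : {ffun 'I_N -> bool}) a i j,
    box (dmin M) (dmax M) a -> d i -> d j ->
    `|partial i (partial j (G M d)) a| <= alpha_G M;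
  lipS_meas : measurable_fun setT (@lipS R N M);
  lipS_second_moment : ('E_(Pr M)[fun w => (lipS (env 1 w) ^+ 2)%R] < +oo)%E;
  u_lipschitz : forall i a a' d s,
    box (dmin M) (dmax M) a -> box (dmin M) (dmax M) a' ->
    `|@u R N M i a d s - u i a' d s|
      <= lipS s * euclidean_norm (mask d (a - a'))
}.

Record step_parameters (R : realType) (N : nat) (M : dosp_model R N) : Prop :=
  StepParameters {
  beta0_gt0 : 0 < beta0 M;
  gamma0_gt0 : 0 < gamma0 M;
  c1_range : 2^-1 < c1 M < 1;
  c2_range : 0 < c2 M <= 1 - c1 M;
  perturbation_room : exists K0 : nat, forall l i, (0 < l)%N -> (K0 <= l)%N ->
    alpha_Phi M * gamma M l
      <= Num.min `|amax M 0 i - astar M 0 i| `|amin M 0 i - astar M 0 i|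
}.

(* [act k] is the vector a_k produced by the algorithm. *)
Record dosp_s (R : realType) (N : nat) (M : dosp_model R N)
    (act : nat -> Omega M -> 'rV[R]_N) : Prop := DospS {
  act1_meas : forall i, measurable_fun setT (fun w => act 1 w 0 i);
  act1_range : forall w i,
    amin M 0 i + alpha_Phi M * gammatilde i 1 w <= act 1 w 0 i
      <= amax M 0 i - alpha_Phi M * gammatilde i 1 w;
  act_step : forall k w i, (0 < k)%N ->
    act k.+1 w 0 i =
      Num.min (Num.max (act k w 0 i + ghat i k (act k w) w)
                       (amin M 0 i + alpha_Phi M * gammatilde i k.+1 w))
              (amax M 0 i - alpha_Phi M * gammatilde i k.+1 w)
}.

(* Main.v *)
Require Import Defs.
From HB Require Import structures.
From mathcomp Require Import all_boot all_order all_algebra.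
From mathcomp Require Import all_classical all_reals all_analysis.
From mathcomp Require Import measurable_realfun.
From mathcomp Require Import ring lra.

(** The idea of the proof.  Fix a slot [k] and an action [a], and let
    [h j = gammatilde j * Phi j] be the displacement that leads from [a] to the
    performed action [p].

    In the mean of [ghat i] the observation noise disappears, since it is centered
    and independent of the rest; the indicator of a reception has mean [qr], which
    the factor [1 / qr] cancels.  Thus [gbar i] is the mean of
    [betatilde i * Phi i * f], where [f] is the total utility at [p]
    ([gbar_utilities]), and averaging the environment replaces [f] by [G] at [p]
    ([gbar_G]).  Now expand [G] at [a] to the second order ([taylor2_box]).  The
    value at [a] and the slopes in the directions [j != i] are multiplied by the
    centered independent factor [Phi i] and vanish.  The slope in the direction
    [i] gives [sigma_Phi ^ 2] times the mean of
    [betatilde i * gammatilde i * partial i G].  Since an active node uses the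
    counter [elltilde i + 1], independent of the activity vector, this mean is
    the product of [betagamma / qa] and of the mean of [partial i G] over active
    [i]; the latter is [partial i F], because [G] does not depend on the action of
    an inactive node ([mean_active_partial_G]).  So the bias is the normalized
    Taylor remainder, and the Hessian bound gives the first claim
    ([gbar_expansion], [bias_le]).

    For the second claim let [X j = elltilde j + 1].  As [c1 + 2 c2 <= 2], the product
    of three powers of counters is at most [k ^ -(c1 + 2 c2)] times
    [1 + (k / X i) ^ 2 + (k / X j1) ^ 2 + (k / X j2) ^ 2], and the mean of
    [(k / X) ^ 2] is at most [2 / qa ^ 2] by an identity between binomial
    coefficients ([mean_binomial_inverse_square]).  As [X i <= k], the mean of
    [beta * gamma] at [X i] is at least a multiple of [k ^ -(c1 + c2)].  Hence the
    weight is [O(k ^ -c2)] ([weight_le]).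

    The utilities are regular only on a box that may be the action set itself.  A
    performable action always belongs to this box ([performable_box]), and the
    derivatives of functions that agree in the box agree up to its boundary
    ([eq_partial_box]).  Each averaging step integrates one source against the
    sigma-algebra of all the others ([independent_rest], [independent_Fubini]);
    the joint measurability that Fubini's theorem needs comes from the Lipschitz
    condition ([measurable_lipschitz_param]). *)

Set Implicit Arguments.
Unset Strict Implicit.
Unset Printing Implicit Defensive.
Import Order.TTheory GRing.Theory Num.Theory numFieldNormedType.Exports.
(* Some of these names, such as eta and mask, also occur in the libraries. *)
Import Defs.
Local Open Scope classical_set_scope.
Local Open Scope ring_scope.

(** * Means of real random variables *)

Lemma normr_bool_le1 (R : realDomainType) (b : bool) : `|b%:R : R| <= 1.
Proof. by rewrite ger0_norm ?ler0n// lern1 leq_b1. Qed.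

Section real_expectation.
Context d (T : measurableType d) (R : realType) (P : probability T R).
Implicit Types f g : T -> R.

(** Integrability stated for real-valued functions, so that linear combinations
    and products are formed in [R] and not in the extended reals. *)
Definition has_mean f := P.-integrable setT (fun w => (f w)%:E).

Lemma has_mean_measurable f : has_mean f -> measurable_fun setT f.
Proof. by move=> /integrableP[/measurable_EFinP]. Qed.

Lemma has_mean_le f g : measurable_fun setT f ->
  (forall w, `|f w| <= g w) -> has_mean g -> has_mean f.
Proof.
move=> mf fg; apply: le_integrable => //; first exact/measurable_EFinP.
by move=> w _; rewrite /= lee_fin (le_trans (fg w))// ler_norm.
Qed.

Lemma has_mean_cst c : has_mean (fun=> c).
Proof.
apply/integrableP; split => //.
by rewrite integral_cst//= probability_setT mule1 ltry.
Qed.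

Lemma has_mean_bounded f c : measurable_fun setT f ->
  (forall w, `|f w| <= c) -> has_mean f.
Proof. by move=> mf fc; apply: (has_mean_le mf fc); exact: has_mean_cst. Qed.

Lemma has_meanZ c f : has_mean f -> has_mean (fun w => c * f w).
Proof. by move=> ?; rewrite /has_mean; under eq_fun do rewrite EFinM; exact: integrableZl. Qed.

Lemma has_meanD f g : has_mean f -> has_mean g -> has_mean (fun w => f w + g w).
Proof. by move=> ? ?; rewrite /has_mean; under eq_fun do rewrite EFinD; exact: integrableD. Qed.

Lemma has_meanB f g : has_mean f -> has_mean g -> has_mean (fun w => f w - g w).
Proof. by move=> ? ?; rewrite /has_mean; under eq_fun do rewrite EFinB; exact: integrableB. Qed.

Lemma has_mean_norm f : has_mean f -> has_mean (fun w => `|f w|).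
Proof. by move=> sf; exact: integrable_abse sf. Qed.

Lemma has_mean_sum (I : Type) (r : seq I) (p : pred I) (f : I -> T -> R) :
  (forall i, has_mean (f i)) -> has_mean (fun w => \sum_(i <- r | p i) f i w).
Proof.
move=> sf; elim: r => [|i r IH].
  by under eq_fun do rewrite big_nil; exact: has_mean_cst.
under eq_fun do rewrite big_cons.
by case: (p i) => //; exact: has_meanD.
Qed.

Lemma has_mean_mul_bounded f g c : measurable_fun setT f ->
  (forall w, `|f w| <= c) -> has_mean g -> has_mean (fun w => f w * g w).
Proof.
move=> mf fc sg; apply: (@has_mean_le _ (fun w => c * `|g w|)).
- by apply: measurable_funM => //; exact: has_mean_measurable.
- by move=> w; rewrite normrM ler_wpM2r.
- exact/has_meanZ/has_mean_norm.
Qed.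

Lemma mean_sum (I : Type) (r : seq I) (p : pred I) (f : I -> T -> R) :
  (forall i, has_mean (f i)) ->
  \int[P]_w (\sum_(i <- r | p i) f i w) = \sum_(i <- r | p i) \int[P]_w f i w.
Proof.
move=> sf; elim: r => [|i r IH].
  under eq_Rintegral do rewrite big_nil.
  by rewrite big_nil Rintegral_cst// mul0r.
under eq_Rintegral do rewrite big_cons.
rewrite big_cons; case: (p i) => //.
by rewrite RintegralD ?IH//; [exact: sf|exact: (has_mean_sum r p sf)].
Qed.

Lemma mean_cst c : \int[P]_w c = c.
Proof.
have P1 : fine (P [set: T]) = 1 by rewrite probability_setT.
by rewrite Rintegral_cst// (_ : fine _ = 1) ?mulr1.
Qed.

Lemma mean_bool (b : T -> bool) : measurable [set w | b w] ->
  \int[P]_w (b w)%:R = fine (P [set w | b w]).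
Proof.
move=> mb; rewrite /Rintegral; congr fine.
rewrite -[in RHS](setIT [set w | b w]) -integral_indic//.
apply: eq_integral => w _; rewrite indicE; congr (_%:R%:E).
by case: (boolP (b w)) => bw; [rewrite mem_set|rewrite memNset//=; exact/negP].
Qed.

Lemma mean_norm_le f g : has_mean f -> has_mean g ->
  (forall w, `|f w| <= g w) -> `|\int[P]_w f w| <= \int[P]_w g w.
Proof.
move=> sf sg fg; apply: le_trans (le_normr_Rintegral _ sf) _ => //.
by apply: le_Rintegral => //; exact: has_mean_norm.
Qed.

End real_expectation.

(** * Independence and averaging over one source *)

Section independence.
Context d (T : measurableType d) (R : realType) (P : probability T R).

Definition independent_pair d1 d2 (T1 : measurableType d1)
    (T2 : measurableType d2) (X : T -> T1) (Y : T -> T2) : Prop :=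
  forall A B, measurable A -> measurable B ->
    P (X @^-1` A `&` Y @^-1` B) = (P (X @^-1` A) * P (Y @^-1` B))%E.

(** In a mutually independent family of sources, the sigma-algebra generated by
    all sources but one is independent of the remaining one.  This is the only
    form in which independence is used below: each averaging step integrates
    out exactly one source. *)
Section rest.
Context (I : eqType) (F : I -> set (set T)).

(** The finite intersections of events of the other sources.  Unlike the union
    of these families, they form a pi-system, which is what the uniqueness
    theorem for finite measures asks for. *)
Definition rest (x : I) : set (set T) :=
  [set E | exists (s : seq I) (A : I -> set T),
    [/\ uniq s, x \notin s, forall i, i \in s -> F i (A i) &
        E = \bigcap_(i in [set` s]) A i]].

Hypothesis FT : forall i, F i setT.
Hypothesis FI : forall i, setI_closed (F i).
Hypothesis Fm : forall i, F i `<=` measurable.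

Lemma sub_rest x i : i != x -> F i `<=` rest x.
Proof.
move=> ix E FE; exists [:: i], (fun=> E); split => //.
- by rewrite inE eq_sym.
- by move=> j; rewrite inE => /eqP ->.
- by apply/seteqP; split => [t Et j _ //|t /(_ i)]; apply; rewrite /= inE.
Qed.

Lemma rest_measurable x : rest x `<=` measurable.
Proof.
move=> _ [s [A [_ _ FA ->]]].
by apply: fin_bigcap_measurable => // i /= is_; exact/Fm/FA.
Qed.

Lemma restI x : setI_closed (rest x).
Proof.
move=> _ _ [s [A [us xs FA ->]]] [t [B [ut xt FB ->]]].
exists (undup (s ++ t)), (fun i => (if i \in s then A i else setT) `&`
  (if i \in t then B i else setT)); split.
- exact: undup_uniq.
- by rewrite mem_undup mem_cat negb_or xs.
- move=> i _; apply: FI; case: ifPn => //; by [exact: FA | exact: FB].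
- apply/seteqP; split => [w [wA wB] i /=|w wAB].
    by move=> _; split; case: ifPn => // ?; [exact: wA|exact: wB].
  split => i /= ii; have := wAB i; rewrite /= mem_undup mem_cat ii ?orbT.
    by move=> /(_ isT)[].
  by move=> /(_ isT)[].
Qed.

Lemma restT x : rest x setT.
Proof.
by exists [::], (fun=> setT); split => //; apply/seteqP; split => // t _ i.
Qed.

Lemma rest_sigma_measurable x : <<s rest x >> `<=` measurable.
Proof.
by apply: smallest_sub; [exact: sigma_algebra_measurable|exact: rest_measurable].
Qed.

(** For a fixed event [Y @^-1` B], both sides are finite measures in the event
    of the other sources, and they agree on a pi-system by mutual
    independence. *)
Lemma independent_rest d2 (T2 : measurableType d2) (Y : T -> T2) x :
  mutually_independent P F -> (forall B, measurable B -> F x (Y @^-1` B)) ->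
  independent_pair (idfun : T -> g_sigma_algebraType (rest x)) Y.
Proof.
move=> indF FY A B mA mB; rewrite preimage_id.
have mYB : measurable (Y @^-1` B) by apply: Fm; exact: FY.
pose p : {nonneg R} := NngNum (fine_ge0 (measure_ge0 P (Y @^-1` B))).
have pE : p%:num%:E = P (Y @^-1` B) by rewrite /= fineK// fin_num_measure.
have key E : rest x E -> mrestr P mYB E = mscale p P E.
  move=> [s [C [us xs FC ->]]].
  rewrite /mrestr /mscale pE.
  set C' := fun i => if i == x then Y @^-1` B else C i.
  have C'C i : i \in s -> C' i = C i.
    by move=> si; rewrite /C'; case: eqP => // ix; rewrite -ix si in xs.
  have := indF (x :: s).
  rewrite /= xs us => /(_ isT C') h.
  have -> : \bigcap_(i in [set` s]) C i `&` Y @^-1` B =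
            \bigcap_(i in [set` x :: s]) C' i.
    apply/seteqP; split => [w [wC wB] i /=|w wC'].
      by rewrite inE => /predU1P[->|si]; [rewrite /C' eqxx|rewrite C'C//; exact: wC].
    split => [i /= si|]; first by rewrite -C'C//; apply: wC'; rewrite /= inE si orbT.
    by have := wC' x; rewrite /= /C' eqxx; apply; exact: mem_head.
  rewrite h; last first.
    move=> i; rewrite inE => /predU1P[->|si]; last by rewrite C'C//; exact: FC.
    by rewrite /C' eqxx; exact: FY.
  have := indF s us C FC => hs.
  rewrite hs big_cons {1}/C' eqxx EFinM fineK ?fin_num_measure//.
  by congr (_ * (_)%:E)%E; apply: eq_big_seq => i si; rewrite C'C.
have := @g_sigma_algebra_measure_unique _ _ _ (rest x) (rest_measurable (x:=x))
  (fun=> setT) (fun=> restT x) _ (mrestr P mYB) (mscale p P) (restI (x:=x)) key.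
have cT : \bigcup_(k : nat) setT = [set: T] by apply: bigcup_const; exists 0%N.
move=> /(_ cT) h; have := h _ A mA; rewrite /= /mrestr /mscale pE => ->.
  by rewrite muleC.
by move=> _; rewrite setTI (le_lt_trans (probability_le1 _ _))// ltry.
Qed.

Lemma rest_measurable_fun x i d' (T' : measurableType d') (f : T -> T') :
  i != x -> preimage_set_system setT f measurable `<=` F i ->
  measurable_fun setT (f : g_sigma_algebraType (rest x) -> T').
Proof.
move=> ix fF _ B mB; apply: sub_sigma_algebra; apply: (sub_rest ix); apply: fF.
by exists B.
Qed.

Lemma rest_measurable_funW x d' (T' : measurableType d') (f : T -> T') :
  measurable_fun setT (f : g_sigma_algebraType (rest x) -> T') ->
  measurable_fun setT f.
Proof.
by move=> mf _ B mB; apply: (rest_sigma_measurable (x:=x)); exact: mf.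
Qed.

End rest.

Section fubini.
Context d1 d2 (T1 : measurableType d1) (T2 : measurableType d2).
Variables (X : T -> T1) (Y : T -> T2).
Hypotheses (mX : measurable_fun setT X) (mY : measurable_fun setT Y).
Hypothesis XY : independent_pair X Y.

(** The law of [(X, Y)] is the product of the two laws, so Fubini's theorem for
    the product measure can be read back on the probability space.  It lets one
    source be averaged while everything else is held fixed. *)
Lemma independent_Fubini (f : T1 * T2 -> R) :
  measurable_fun setT f ->
  P.-integrable setT (fun w => (f (X w, Y w))%:E) ->
  (forall w, P.-integrable setT (fun w' => (f (X w, Y w'))%:E)) ->
  P.-integrable setT (fun w => (\int[P]_w' f (X w, Y w'))%:E) /\
  \int[P]_w f (X w, Y w) = \int[P]_w \int[P]_w' f (X w, Y w').
Proof.
move=> mf intf intfw.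
pose X' : {RV P >-> T1} := HB.pack X (isMeasurableFun.Build _ _ _ _ _ mX).
pose Y' : {RV P >-> T2} := HB.pack Y (isMeasurableFun.Build _ _ _ _ _ mY).
have mZ : measurable_fun setT (fun w => (X w, Y w)) by apply: measurable_fun_pair.
pose Z' : {RV P >-> (T1 * T2)%type} :=
  HB.pack (fun w => (X w, Y w)) (isMeasurableFun.Build _ _ _ _ _ mZ).
pose mu1 := distribution P X'; pose mu2 := distribution P Y'.
have muE A : measurable A -> (mu1 \x mu2)%E A = distribution P Z' A.
  by apply: product_measure_unique => B C mB mC; exact: XY.
have eqI (h : T1 * T2 -> \bar R) :
    (\int[(mu1 \x mu2)%E]_z h z = \int[distribution P Z']_z h z)%E.
  by apply: eq_measure_integral => A mA _; exact: muE.
pose Ef : T1 * T2 -> \bar R := EFin \o f.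
have mEf : measurable_fun setT Ef by exact/measurable_EFinP.
have intZ : (distribution P Z').-integrable setT Ef.
  by apply: integrable_pushforward.
have intXY : (mu1 \x mu2)%E.-integrable setT Ef.
  apply/integrableP; split => //.
  by rewrite eqI; case/integrableP : intZ.
have FE w : fubini_F mu2 Ef (X w) = (\int[P]_w' f (X w, Y w'))%:E.
  have mfw : measurable_fun setT (fun y => Ef (X w, y)).
    by apply: measurableT_comp => //; exact: measurable_fun_pair.
  rewrite /fubini_F (@integral_distribution _ _ _ _ _ P Y' _ mfw (intfw w)).
  by rewrite /Rintegral fineK// integrable_fin_num.
have intF := integrable_fubini_F intXY.
have mF : measurable_fun setT (fubini_F mu2 Ef).
  by case/integrableP : intF.
have intFX : P.-integrable setT (fubini_F mu2 Ef \o X).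
  apply/integrableP; split; first exact: measurableT_comp.
  case/integrableP : intF => _; rewrite ge0_integral_distribution//.
  exact: measurableT_comp.
split.
  by move: intFX; congr integrable; apply/funext => w; rewrite /= FE.
rewrite /Rintegral; congr fine.
transitivity (\int[distribution P Z']_z Ef z)%E.
  by rewrite integral_distribution.
rewrite -eqI -integral12_prod_meas1// integral_distribution//.
by apply: eq_integral => w _; rewrite /= FE.
Qed.

Lemma independent_mean_mul (f : T1 -> R) (g : T2 -> R) :
  measurable_fun setT f -> measurable_fun setT g ->
  P.-integrable setT (fun w => (f (X w))%:E) ->
  P.-integrable setT (fun w => (g (Y w))%:E) ->
  P.-integrable setT (fun w => (f (X w) * g (Y w))%:E) ->
  \int[P]_w (f (X w) * g (Y w)) = (\int[P]_w f (X w)) * (\int[P]_w g (Y w)).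
Proof.
move=> mf mg intf intg intfg.
have [] := @independent_Fubini (fun z => f z.1 * g z.2) _ intfg.
- by apply: measurable_funM; exact: measurableT_comp.
- by move=> w /=; under eq_fun do rewrite EFinM; exact: integrableZl.
- move=> _ ->; rewrite -RintegralZr//.
  by apply: eq_Rintegral => w _ /=; rewrite RintegralZl.
Qed.

End fubini.
End independence.

(** * Measurability of a field evaluated at a random point *)

(** A field [v a s] that is measurable in [s] and Lipschitz in [a] on a box is
    jointly measurable there: it is the limit of its values at the points
    obtained by rounding [a].  The field is not known to be regular outside the
    box, so the rounding must not leave the box; rounding each coordinate down
    and then clipping it from below by [lo] has this property. *)
Section joint_measurability.
Context d1 d2 (T1 : measurableType d1) (T2 : measurableType d2).
Context (R : realType) (N : nat) (lo hi : 'rV[R]_N).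

Let grid (n : nat) (c : {ffun 'I_N -> int}) : 'rV[R]_N :=
  \row_i Num.max (lo 0 i) ((c i)%:~R / n.+1%:R).

Let cell (n : nat) (a : 'rV[R]_N) : {ffun 'I_N -> int} :=
  [ffun i => Num.floor (n.+1%:R * a 0 i)].

Let grid_dist n a i : box lo hi a ->
  lo 0 i <= grid n (cell n a) 0 i <= a 0 i /\
  `|grid n (cell n a) 0 i - a 0 i| <= n.+1%:R^-1.
Proof.
move=> /(_ i)/andP[loa _]; rewrite !mxE ffunE.
set m := (Num.floor _)%:~R.
have n0 : (0 : R) < n.+1%:R by rewrite ltr0n.
have h1 : m / n.+1%:R <= a 0 i.
  by rewrite ler_pdivrMr// mulrC /m floor_le.
have h2 : a 0 i - n.+1%:R^-1 <= m / n.+1%:R.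
  rewrite -[a 0 i](@mulfK _ n.+1%:R) ?gt_eqF// -{2}[n.+1%:R^-1]mul1r -mulrBl.
  rewrite ler_pM2r ?invr_gt0// lerBlDr.
  by rewrite [a 0 i * _]mulrC ltW// /m -[1]/(1%:~R) -intrD floorD1_gt.
have h3 : Num.max (lo 0 i) (m / n.+1%:R) <= a 0 i by rewrite ge_max loa.
split; first by rewrite h3 le_max lexx.
rewrite ler0_norm ?subr_le0// opprB lerBlDr -lerBlDl (le_trans h2)//.
by rewrite le_max lexx orbT.
Qed.

Variables (p : T1 -> 'rV[R]_N) (v : 'rV[R]_N -> T2 -> R) (L : T2 -> R).
Hypothesis mp : forall i, measurable_fun setT (fun x => p x 0 i).
Hypothesis pbox : forall x, box lo hi (p x).
Hypothesis mv : forall a, box lo hi a -> measurable_fun setT (v a).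
Hypothesis lipv : forall a a' s, box lo hi a -> box lo hi a' ->
  `|v a s - v a' s| <= L s * \sum_i `|a 0 i - a' 0 i|.

Let gridbox n x : box lo hi (grid n (cell n (p x))).
Proof.
move=> i; have [/andP[-> le] _] := grid_dist n i (pbox x).
by rewrite (le_trans le)//; have /andP[] := pbox x i.
Qed.

(** The rounded point takes countably many values, so the preimage of a set is
    a countable union of measurable rectangles. *)
Let mgrid n : measurable_fun setT
  (fun z : T1 * T2 => v (grid n (cell n (p z.1))) z.2).
Proof.
move=> _ Y mY; rewrite setTI.
pose A (c : {ffun 'I_N -> int}) := \bigcap_(i in [set: 'I_N])
  (fun x => n.+1%:R * p x 0 i) @^-1` `[(c i)%:~R, (c i)%:~R + 1[.
(* grid points outside the box are never reached, and v is unspecified there *)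
pose B c := if `[< box lo hi (grid n c) >] then v (grid n c) @^-1` Y else set0.
have AE c x : A c x <-> cell n (p x) = c.
  split => [Ax|<- i _].
    apply/ffunP => i; rewrite ffunE; apply: floor_def.
    by have := Ax i I; rewrite /= in_itv /= -[1]/(1%:~R) -intrD.
  by rewrite /= in_itv /= ffunE floor_le /= -[1]/(1%:~R) -intrD floorD1_gt.
rewrite (_ : _ @^-1` _ = \bigcup_c (A c `*` B c)).
  apply: countable_bigcupT_measurable => [|c].
    exact: countableP.
  apply: measurableX.
    apply: fin_bigcap_measurable; first exact: finite_finset.
    move=> i _; rewrite -[X in measurable X]setTI.
    by apply: measurable_funM => //; exact: measurable_itv.
  rewrite /B; case: asboolP => // bc.
  by rewrite -[X in measurable X]setTI; exact: mv.
apply/seteqP; split => [[x s] /= Yz|[x s] [c _ [/= /AE <-]]].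
  exists (cell n (p x)) => //; split => /=; first exact/AE.
  by rewrite /B; case: asboolP => // /(_ (gridbox n x)).
by rewrite /B; case: asboolP.
Qed.

Lemma measurable_lipschitz_param :
  measurable_fun setT (fun z : T1 * T2 => v (p z.1) z.2).
Proof.
apply: (measurable_fun_cvg mgrid) => -[x s] _ /=.
have L0 : (fun n => v (p x) s - (`|L s| * N%:R) * harmonic n) @ \oo --> v (p x) s.
  rewrite -[X in _ --> X]subr0; apply: cvgB; first exact: cvg_cst.
  rewrite -[X in _ --> X](mulr0 (`|L s| * N%:R)).
  by apply: cvgM; [exact: cvg_cst|exact: cvg_harmonic].
have L1 : (fun n => v (p x) s + (`|L s| * N%:R) * harmonic n) @ \oo --> v (p x) s.
  rewrite -[X in _ --> X]addr0; apply: cvgD; first exact: cvg_cst.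
  rewrite -[X in _ --> X](mulr0 (`|L s| * N%:R)).
  by apply: cvgM; [exact: cvg_cst|exact: cvg_harmonic].
apply: (squeeze_cvgr _ L0 L1); near=> n.
rewrite -ler_distl.
apply: (le_trans (lipv _ (gridbox n x) (pbox x))).
rewrite -mulrA (le_trans (ler_wpM2r _ (ler_norm _)))//; first exact: sumr_ge0.
apply: ler_wpM2l => //; apply: (@le_trans _ _ (\sum_(i < N) n.+1%:R^-1)).
  by apply: ler_sum => i _; have [_] := grid_dist n i (pbox x).
by rewrite sumr_const card_ord mulr_natl.
Unshelve. all: by end_near. Qed.

End joint_measurability.

(** * Second-order expansion in a box *)

Section calculus.
Context (R : realType) (N : nat).
Implicit Types (a h : 'rV[R]_N) (f g : 'rV[R]_N -> R).

Lemma derive_partial f a h : differentiable f a ->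
  'D_h f a = \sum_i h 0 i * partial i f a.
Proof.
move=> df; rewrite deriveE// {1}(row_sum_delta h) linear_sum.
by apply: eq_bigr => i _; rewrite linearZ /= /partial deriveE.
Qed.

Lemma is_derive_line f a h (t : R) : differentiable f (a + t *: h) ->
  is_derive t 1 (fun s => f (a + s *: h))
    (\sum_i h 0 i * partial i f (a + t *: h)).
Proof.
move=> df; have D : derivable f (a + t *: h) h by exact: diff_derivable.
have qE : (fun s : R => s^-1 *: (((fun r => f (a + r *: h)) \o shift t) (s *: 1)
              - f (a + t *: h))) =
          (fun s : R => s^-1 *: ((f \o shift (a + t *: h)) (s *: h)
              - f (a + t *: h))).
  apply/funext => s /=; congr (_ *: (f _ - _)).
  by rewrite [s%:A]mulr1 scalerDl addrCA.
apply: DeriveDef; first by rewrite /derivable qE.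
by rewrite /derive qE -derive_partial.
Qed.

Lemma box_line lo hi a h t : 0 <= t <= 1 -> box lo hi a -> box lo hi (a + h) ->
  box lo hi (a + t *: h).
Proof.
move=> t01 ba bah i; have := ba i; have := bah i; rewrite !mxE; nra.
Qed.

(** Two applications of the mean value theorem: [f1] moves by at most [K * t],
    hence [e * (f t - f1 0 * t) - K / 2 * t ^ 2] is nonincreasing, for [e] equal
    to 1 or -1.  The mean value theorem stands in for an integral remainder, as
    [f2] may be discontinuous. *)
Lemma taylor2_segment (f f1 f2 : R -> R) (K : R) :
  (forall t : R, 0 <= t <= 1 -> is_derive t 1 f (f1 t)) ->
  (forall t : R, 0 <= t <= 1 -> is_derive t 1 f1 (f2 t)) ->
  (forall t : R, 0 <= t <= 1 -> `|f2 t| <= K) ->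
  `|f 1 - f 0 - f1 0| <= K / 2.
Proof.
move=> df df1 f2K.
have ctn (F F' : R -> R) (b : R) : b <= 1 ->
    (forall t : R, 0 <= t <= 1 -> is_derive t 1 F (F' t)) ->
    {within `[0, b], continuous F}.
  move=> b1 dF; apply: derivable_within_continuous => t; rewrite in_itv/= => tb.
  by have := dF t; case => //; lra.
have h1 (t : R) : 0 <= t <= 1 -> `|f1 t - f1 0| <= K * t.
  move=> /andP[t0 t1].
  have dt (c : R) : c \in `]0, t[ -> is_derive c 1 f1 (f2 c).
    by rewrite in_itv/= => ct; apply: df1; lra.
  have [c + ->] := MVT_segment t0 dt (ctn _ _ _ t1 df1).
  rewrite in_itv/= => ct; rewrite subr0 normrM (ger0_norm t0).
  by apply: ler_wpM2r => //; apply: f2K; lra.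
have dsq (c t : R) : is_derive t 1 (fun s : R => c * s - K / 2 * s ^+ 2) (c - K * t).
  apply: is_derive_eq; rewrite /GRing.scale /=; lra.
have key (e : R) : e = 1 \/ e = -1 -> e * (f 1 - f 0 - f1 0) <= K / 2.
  move=> e1.
  pose psi t := e * f t + (- (e * f1 0) * t - K / 2 * t ^+ 2).
  have dpsi (t : R) : 0 <= t <= 1 ->
      is_derive t 1 psi (e * f1 t + (- (e * f1 0) - K * t)).
    move=> t01; have := df t t01; have := dsq (- (e * f1 0)) t => d2 d1.
    have d3 : is_derive t 1 (e *: f) (e * f1 t) by apply: is_deriveZ.
    exact: (is_deriveD d3 d2).
  have dt (t : R) : t \in `]0, 1[ ->
      is_derive t 1 psi (e * f1 t + (- (e * f1 0) - K * t)).
    by rewrite in_itv/= => t01; apply: dpsi; lra.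
  have [c] := MVT_segment ler01 dt (ctn _ _ _ (lexx _) dpsi).
  rewrite in_itv/= /psi => c01; have := h1 c c01; rewrite ler_norml.
  by case: e1 => ->; lra.
rewrite ler_norml; have := key 1; have := key (-1) => k1 k2.
by have := k1 (or_intror erefl); have := k2 (or_introl erefl); lra.
Qed.

Lemma taylor2_box (lo hi : 'rV[R]_N) f a h (K : R) :
  twice_differentiable_on (box lo hi) f -> box lo hi a -> box lo hi (a + h) ->
  (forall x, box lo hi x ->
    `|\sum_i \sum_j h 0 i * h 0 j * partial j (partial i f) x| <= K) ->
  `|f (a + h) - f a - \sum_i h 0 i * partial i f a| <= K / 2.
Proof.
move=> df ba bah fK.
have bt t : 0 <= t <= 1 -> box lo hi (a + t *: h) by move=> ?; exact: box_line.
have := @taylor2_segment (fun t => f (a + t *: h))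
  (fun t => \sum_i h 0 i * partial i f (a + t *: h))
  (fun t => \sum_i h 0 i * (\sum_j h 0 j * partial j (partial i f) (a + t *: h))) K.
rewrite scale1r scale0r addr0; apply.
- by move=> t t01; apply: is_derive_line; have [] := df _ (bt t t01).
- move=> t t01; have [_ df1] := df _ (bt t t01).
  rewrite (_ : (fun s => _) = \sum_(i < N) (h 0 i *: (fun s => partial i f (a + s *: h)))).
    by apply: is_derive_sum => i; apply: is_deriveZ; exact: is_derive_line.
  by apply/funext => s; rewrite fct_sumE.
- move=> t t01; apply: le_trans (fK _ (bt t t01)).
  rewrite le_eqVlt; apply/orP; left; apply/eqP; congr `|_|.
  apply: eq_bigr => i _; rewrite big_distrr /=.
  by apply: eq_bigr => j _; rewrite mulrA.
Qed.

(** A partial derivative can be computed from one side.  In a nondegenerate box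
    one of the two sides of [a] lies in the box even when [a] is on the
    boundary. *)
Lemma eq_partial_box (lo hi : 'rV[R]_N) f g a i :
  lo 0 i < hi 0 i -> box lo hi a ->
  differentiable f a -> differentiable g a ->
  (forall t, box lo hi (a + t *: delta_mx 0 i) ->
     f (a + t *: delta_mx 0 i) = g (a + t *: delta_mx 0 i)) ->
  partial i f a = partial i g a.
Proof.
move=> lohi ba df dg fg.
have fga : f a = g a by have := fg 0; rewrite scale0r addr0; exact.
have bt t : lo 0 i <= a 0 i + t <= hi 0 i -> box lo hi (a + t *: delta_mx 0 i).
  move=> t_ j; rewrite !mxE eqxx /=; case: eqVneq => [->|_] /=.
    by rewrite mulr1.
  by rewrite mulr0 addr0.
pose q (f : 'rV[R]_N -> R) (s : R) :=
  s^-1 *: ((f \o shift a) (s *: delta_mx 0 i) - f a).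
have qfg s : lo 0 i <= a 0 i + s <= hi 0 i -> q f s = q g s.
  by move=> /bt bs; rewrite /q /= ![_ *: _ + a]addrC fga fg.
have cf : q f @ 0^' --> partial i f a by apply: diff_derivable.
have cg : q g @ 0^' --> partial i g a by apply: diff_derivable.
have /andP[loa ahi] := ba i.
have [ai|ai] := ltP (a 0 i) (hi 0 i).
  have r0 : at_right (0:R) --> (0 : R)^'.
    move=> A A0; apply: (@filterS _ (nbhs (0 : R)) _ (fun x => x != 0 -> A x)) A0.
    by move=> x h x0; apply: h; rewrite gt_eqF.
  apply: (@cvg_unique _ _ (q f @ 0^'+)) => //.
    exact: (cvg_trans (cvg_app _ r0) cf).
  apply: cvg_trans (cvg_trans (cvg_app _ r0) cg); apply: near_eq_cvg.
  near=> s; apply/esym/qfg.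
  have s0 : 0 < s by near: s; exact: nbhs_right_gt.
  have s1 : s < hi 0 i - a 0 i by near: s; apply: nbhs_right_lt; lra.
  lra.
have r0 : at_left (0:R) --> (0 : R)^'.
  move=> A A0; apply: (@filterS _ (nbhs (0 : R)) _ (fun x => x != 0 -> A x)) A0.
    by move=> x h x0; apply: h; rewrite lt_eqF.
apply: (@cvg_unique _ _ (q f @ 0^'-)) => //.
  exact: (cvg_trans (cvg_app _ r0) cf).
apply: cvg_trans (cvg_trans (cvg_app _ r0) cg); apply: near_eq_cvg.
near=> s; apply/esym/qfg.
have s0 : s < 0 by near: s; exact: nbhs_left_lt.
have s1 : lo 0 i - hi 0 i < s by near: s; apply: nbhs_left_gt; lra.
lra.
Unshelve. all: by end_near. Qed.

End calculus.

(** * Inverse moments of the binomial law *)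

Section binomial.
Context (R : realType).

Lemma binomial_pmf_sum n (q : R) : \sum_(m < n.+1) binomial_pmf n q m = 1.
Proof.
rewrite -[RHS](expr1n _ n) -[1 in RHS](subrK q) exprDn.
by apply: eq_bigr => m _; rewrite /binomial_pmf mulrC.
Qed.

(** Since [(n+1) (n+2) C(n, m) = (m+1) (m+2) C(n+2, m+2)], dividing by
    [(m+1) (m+2)] under a binomial law gives back a binomial law. *)
Lemma binomial_pmf_shift2 n (q : R) m :
  q ^+ 2 * (n.+1 * n.+2)%:R * binomial_pmf n q m =
  (m.+1 * m.+2)%:R * binomial_pmf n.+2 q m.+2.
Proof.
rewrite /binomial_pmf !subSS -[_ *+ 'C(n, m)]mulr_natr -[_ *+ 'C(n.+2, m.+2)]mulr_natr.
have /= e1 := mul_bin_diag n.+2 m.+1; have /= e2 := mul_bin_diag n.+1 m.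
have e : (n.+1 * n.+2 * 'C(n, m) = m.+1 * m.+2 * 'C(n.+2, m.+2))%N.
  by rewrite [(n.+1 * _)%N]mulnC -mulnA e2 mulnCA e1 mulnA.
rewrite -[_ * _%:R * _]mulrA [(_ * n.+2)%:R * _]mulrCA -natrM e natrM !exprS; ring.
Qed.

(** A random step counter is of the order of [n] up to a bounded factor in
    quadratic mean.  Chebyshev's inequality would only bound the probability of
    a small counter by a multiple of [1 / n], which is too weak to be divided by
    the mean of the step products. *)
Lemma binomial_inverse_square n (q : R) : 0 < q <= 1 ->
  \sum_(m < n.+1) (n.+1%:R / m.+1%:R) ^+ 2 * binomial_pmf n q m <= 2 / q ^+ 2.
Proof.
move=> /andP[q0 q1]; have q01 : 0 <= q <= 1 by rewrite ltW.
have q20 : 0 < q ^+ 2 by rewrite exprn_gt0.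
apply: (@le_trans _ _ (\sum_(m < n.+1) 2 / q ^+ 2 * binomial_pmf n.+2 q m.+2)).
  apply: ler_sum => m _.
  rewrite [leRHS]mulrAC ler_pdivlMr// -mulrA.
  have -> : binomial_pmf n q m * q ^+ 2 =
      (m.+1 * m.+2)%:R * binomial_pmf n.+2 q m.+2 / (n.+1 * n.+2)%:R.
    by rewrite -binomial_pmf_shift2 mulrAC mulfK ?pnatr_eq0// mulrC.
  have B0 := binomial_pmf_ge0 n.+2 m.+2 q01.
  set B := binomial_pmf _ _ _ in B0 *.
  rewrite !natrM.
  have m0 : (0 : R) < m.+1%:R by rewrite ltr0n.
  have n0 : (0 : R) < n.+1%:R by rewrite ltr0n.
  have n2 : (n.+2%:R : R) = n.+1%:R + 1 by rewrite -natr1.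
  have m2 : (m.+2%:R : R) = m.+1%:R + 1 by rewrite -natr1.
  have m1 : (1 : R) <= m.+1%:R by rewrite ler1n.
  have n1 : (1 : R) <= n.+1%:R by rewrite ler1n.
  rewrite n2 m2; set x := n.+1%:R in n0 n1 *; set y := m.+1%:R in m0 m1 *.
  have -> : (x / y) ^+ 2 * (y * (y + 1) * B / (x * (x + 1))) =
    (x * (y + 1)) / (y * (x + 1)) * B.
    by field; rewrite !gt_eqF//; lra.
  apply: ler_wpM2r => //.
  rewrite ler_pdivrMr; last by nra.
  nra.
rewrite -mulr_sumr -[leRHS]mulr1; apply: ler_wpM2l.
  by rewrite divr_ge0// ltW.
have := binomial_pmf_sum n.+2 q; rewrite big_ord_recl big_ord_recl /= => <-.
by rewrite addrA lerDr addr_ge0// binomial_pmf_ge0.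
Qed.

Context d (T : measurableType d) (P : probability T R) (L : T -> nat).
Variables (n : nat) (q : R).
Hypothesis mL : measurable_fun setT L.
Hypothesis q01 : 0 < q <= 1.
Hypothesis lawL : forall m, P [set w | L w = m] = (binomial_pmf n q m)%:E.

(** The counter exceeds [n] on a null set only, so the infinite range of [L] can be
    cut off almost everywhere. *)
Lemma mean_binomial (h : nat -> R) c : (forall m, `|h m| <= c) ->
  \int[P]_w h (L w) = \sum_(m < n.+1) h m * binomial_pmf n q m.
Proof.
move=> hc.
have mh : measurable_fun setT (h \o L) by exact: measurableT_comp.
have mb m : measurable [set w | L w == m].
  rewrite (_ : [set w | _] = L @^-1` [set m]); last first.
    by apply/seteqP; split => w /= /eqP.
  by rewrite -[X in measurable X]setTI; exact: mL.
have mI m : measurable_fun setT (fun w => (L w == m)%:R : R).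
  by apply: (measurableT_comp (f := fun l : nat => (l == m)%:R : R)).
have sI m : has_mean P (fun w => (L w == m)%:R).
  by apply: (@has_mean_bounded _ _ _ _ _ 1) => // w; rewrite ger0_norm ?ler0n// lern1 leq_b1.
transitivity (\int[P]_w (\sum_(m < n.+1) h m * (L w == m)%:R)).
  congr fine; apply: ae_eq_integral => //.
  - exact/measurable_EFinP.
  - by apply/measurable_EFinP; apply: has_mean_measurable; apply: has_mean_sum => i; exact: has_meanZ.
  - have /negligibleS : P.-negligible (\bigcup_k [set w | L w == n.+1 + k]%N).
      apply: negligible_bigcup => k; apply/negligibleP => //.
      have := lawL (n.+1 + k)%N; rewrite /binomial_pmf bin_small ?mulr0n; last first.
        by rewrite addSn ltnS leq_addr.
      by move=> PL; apply: etrans PL; congr (P _); apply/seteqP; split => w /= /eqP.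
    apply => w /= /not_implyP[_ ne]; have [Ln|Ln] := ltnP (L w) n.+1; last first.
      by exists (L w - n.+1)%N => //=; rewrite subnKC.
    exfalso; apply: ne => /=.
    congr EFin; rewrite (bigD1 (Ordinal Ln)) //= eqxx mulr1 big1 ?addr0// => i iL.
    by case: eqP => [e|]; [rewrite -val_eqE /= e eqxx in iL|rewrite mulr0].
rewrite (@mean_sum _ _ _ P); last by move=> i; exact: has_meanZ.
apply: eq_bigr => m _; rewrite RintegralZl; [congr (_ * _)|by []|exact: sI].
rewrite mean_bool// -[RHS]/(fine (binomial_pmf n q m)%:E) -lawL; congr (fine (P _)).
by apply/seteqP; split => w /= /eqP.
Qed.

Lemma mean_binomial_inverse_square :
  \int[P]_w (n.+1%:R / (L w).+1%:R) ^+ 2 <= 2 / q ^+ 2.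
Proof.
rewrite (@mean_binomial (fun m => (n.+1%:R / m.+1%:R) ^+ 2) (n.+1%:R ^+ 2)).
  exact: binomial_inverse_square.
move=> m; rewrite ger0_norm ?sqr_ge0// lerXn2r ?nnegrE ?divr_ge0//.
by rewrite ler_pdivrMr ?ltr0n// ler_peMr// ler1n.
Qed.

End binomial.

Section powers.
Context (R : realType).

(** Put [r = max (1, k/x, k/y, k/z)].  The left-hand side divided by the power of
    [k] is at most [r] to the power [c + 2 c'], hence at most [r ^ 2].  Thus a
    product of powers of possibly dependent variables is controlled by second
    inverse moments of single variables. *)
Lemma powR_prod3_le (k x y z c c' : R) : 1 <= k -> 0 < x -> 0 < y -> 0 < z ->
  0 <= c -> 0 <= c' -> c + 2 * c' <= 2 ->
  x `^ (- c) * y `^ (- c') * z `^ (- c') <=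
  k `^ (- (c + 2 * c')) * (1 + (k / x) ^+ 2 + (k / y) ^+ 2 + (k / z) ^+ 2).
Proof.
move=> k1 x0 y0 z0 c0 c'0 cc'; have k0 : 0 < k by rewrite (lt_le_trans ltr01).
have E t e : 0 < t -> t `^ (- e) = k `^ (- e) * (k / t) `^ e.
  move=> t0; rewrite powRM ?ltW// ?invr_gt0// -[t^-1]powR_inv1 ?ltW//.
  rewrite -[(t `^ (-1)) `^ e]powRrM mulN1r mulrA [k `^ (- e)]powRN.
  by rewrite mulVf ?mul1r// gt_eqF// powR_gt0.
rewrite (E x)// (E y)// (E z)//.
have -> : k `^ (- (c + 2 * c')) = k `^ (- c) * k `^ (- c') * k `^ (- c').
  have -> : - (c + 2 * c') = - c - c' - c' by ring.
  by rewrite !powRD// (gt_eqF k0) implybT.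
set A := k `^ _; set B := k `^ _.
have -> : A * (k / x) `^ c * (B * (k / y) `^ c') * (B * (k / z) `^ c') =
  A * B * B * ((k / x) `^ c * (k / y) `^ c' * (k / z) `^ c') by ring.
apply: ler_wpM2l; first by rewrite !mulr_ge0 ?powR_ge0.
set X := k / x; set Y := k / y; set Z := k / z.
have X0 : 0 < X by rewrite divr_gt0.
have Y0 : 0 < Y by rewrite divr_gt0.
have Z0 : 0 < Z by rewrite divr_gt0.
pose r := Num.max (Num.max 1 X) (Num.max Y Z).
have [r1 rX rY rZ] : [/\ 1 <= r, X <= r, Y <= r & Z <= r].
  by rewrite /r !le_max !lexx !orbT.
have r0 : 0 < r by lra.
have P e t : 0 <= e -> 0 < t -> t <= r -> t `^ e <= r `^ e.
  by move=> e0 t0 tr; rewrite ge0_ler_powR ?nnegrE// ltW.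
apply: (@le_trans _ _ (r `^ c * r `^ c' * r `^ c')).
  by rewrite !ler_pM ?mulr_ge0 ?powR_ge0 ?P.
have rD e e' : r `^ e * r `^ e' = r `^ (e + e').
  by rewrite powRD// (gt_eqF r0) implybT.
rewrite !rD.
apply: (@le_trans _ _ (r `^ 2%:R)); first by apply: ler_powR => //; lra.
rewrite powR_mulrn ?(ltW r0)// /r.
clearbody X Y Z.
have [X2 Y2 Z2] : [/\ 0 <= X ^+ 2, 0 <= Y ^+ 2 & 0 <= Z ^+ 2] by rewrite !sqr_ge0.
by case: (leP (Num.max 1 X) _) => _; [case: (leP Y Z)|case: (leP 1 X)] => _; lra.
Qed.

Lemma cvg_natr_powRN (c : R) : 0 < c -> (k%:R : R) `^ (- c) @[k --> \oo] --> (0 : R).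
Proof.
move=> c0.
have h : (fun k : nat => (k.+1%:R : R) `^ (- c)) @ \oo --> (0 : R).
  have -> : (fun k : nat => (k.+1%:R : R) `^ (- c)) =
      (fun a : R => a `^ c) \o harmonic.
    apply/funext => k; rewrite /harmonic /= -[_^-1]powR_inv1//.
    by rewrite -powRrM mulN1r.
  apply: (@cvg_comp _ _ _ harmonic (fun a : R => a `^ c) _ (0 : R)^'+); last exact: powR_cvg0.
  move=> A; rewrite /at_right /within /= => A0.
  have := @cvg_harmonic R _ A0; apply: (@filterS _ (nbhs \oo)) => k Ak.
  by apply: Ak; rewrite /harmonic /= invr_gt0 ltr0n.
by rewrite -(cvg_shiftS (fun k : nat => (k%:R : R) `^ (- c))).
Qed.

End powers.

(** * Measurability and independence in the model *)

(** Equality of sources is decided by choice, so it does not compute. *)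
Ltac distinct_sources := by move=> *; apply/eqP; case.

Section laws.
Context d (T : measurableType d) (R : realType) (P : probability T R).

Lemma same_law_mean d1 (T1 : measurableType d1) (X Y : T -> T1) (h : T1 -> R) :
  measurable_fun setT X -> measurable_fun setT Y -> measurable_fun setT h ->
  (forall B, measurable B -> P (X @^-1` B) = P (Y @^-1` B)) ->
  has_mean P (h \o X) ->
  has_mean P (h \o Y) /\ \int[P]_w h (Y w) = \int[P]_w h (X w).
Proof.
move=> mX mY mh XY sX.
pose X' : {RV P >-> T1} := HB.pack X (isMeasurableFun.Build _ _ _ _ _ mX).
pose Y' : {RV P >-> T1} := HB.pack Y (isMeasurableFun.Build _ _ _ _ _ mY).
have eqI (g : T1 -> \bar R) :
    (\int[distribution P Y']_z g z = \int[distribution P X']_z g z)%E.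
  by apply: eq_measure_integral => A mA _; exact/esym/XY.
have mEh : measurable_fun setT (EFin \o h) by exact/measurable_EFinP.
have sY : has_mean P (h \o Y).
  apply/integrableP; split; first by apply/measurable_EFinP; exact: measurableT_comp.
  pose ah : T1 -> \bar R := fun x => (`|(h x)%:E|)%E.
  have mah : measurable_fun setT ah by apply: measurableT_comp.
  have ah0 x : (0 <= ah x)%E by exact: abse_ge0.
  have := @ge0_integral_distribution _ _ _ _ _ P Y' ah mah ah0.
  have := @ge0_integral_distribution _ _ _ _ _ P X' ah mah ah0.
  by rewrite eqI => -> <-; case/integrableP : sX.
split => //; rewrite /Rintegral; congr fine.
have := @integral_distribution _ _ _ _ _ P Y' _ mEh sY.
have := @integral_distribution _ _ _ _ _ P X' _ mEh sX.
by rewrite eqI => -> <-.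
Qed.

End laws.

Section discrete_measurability.
Context (R : realType) d (T : measurableType d).

Lemma measurable_bool_natr (b : T -> bool) : measurable_fun setT b ->
  measurable_fun setT (fun w => (b w)%:R : R).
Proof. exact: (measurableT_comp (f := fun c : bool => c%:R : R)). Qed.

Lemma measurable_active_step (b : T -> bool) (l : T -> nat) (h : nat -> R) :
  measurable_fun setT b -> measurable_fun setT l ->
  measurable_fun setT (fun w => (b w)%:R * h (l w + b w)%N).
Proof.
move=> mb ml.
rewrite (_ : (fun w => _) = fun w => (b w)%:R * h (l w).+1); last first.
  by apply/funext => w; case: (b w); rewrite ?mul0r// addn1.
apply: measurable_funM; first exact: measurable_bool_natr.
by apply: (measurableT_comp (f := fun m : nat => h m.+1)).
Qed.

Lemma measurable_ffun_bool (I : finType) (D : I -> T -> bool) (d0 : {ffun I -> bool}) :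
  (forall i, measurable_fun setT (D i)) ->
  measurable_fun setT (fun w => ([ffun i => D i w] == d0)%:R : R).
Proof.
move=> mD; rewrite (_ : (fun w => _) = fun w => \prod_i (D i w == d0 i)%:R).
  apply: measurable_prod => i _.
  by apply: (measurableT_comp (f := fun c : bool => (c == d0 i)%:R : R)).
apply/funext => w; case: eqP => [<-|ne].
  by rewrite big1// => i _; rewrite ffunE eqxx.
have [i Di] : exists i, D i w != d0 i.
  apply/existsP; rewrite -negb_forall; apply/forallP => h.
  by apply: ne; apply/ffunP => i; rewrite ffunE; exact/eqP.
by rewrite (bigD1 i)//= (negbTE Di) mul0r.
Qed.

(** Conditioning on the activity vector, which has finitely many values. *)
Lemma ffun_bool_expand (I : finType) (h : {ffun I -> bool} -> R) d0 :
  h d0 = \sum_c (d0 == c)%:R * h c.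
Proof.
rewrite (bigD1 d0)//= eqxx mul1r big1 ?addr0// => c.
by rewrite eq_sym => /negbTE ->; rewrite mul0r.
Qed.

Lemma measurable_of_ffun_bool (I : finType) (D : I -> T -> bool)
    (h : {ffun I -> bool} -> R) :
  (forall i, measurable_fun setT (D i)) ->
  measurable_fun setT (fun w => h [ffun i => D i w]).
Proof.
move=> mD; under eq_fun do rewrite ffun_bool_expand.
apply: measurable_sum => c; apply: measurable_funM => //.
exact: measurable_ffun_bool.
Qed.

End discrete_measurability.

Lemma euclidean_norm_mask_le (R : realType) (N : nat) (d : {ffun 'I_N -> bool})
  (v : 'rV[R]_N) : euclidean_norm (mask d v) <= \sum_i `|v 0 i|.
Proof.
have S0 : 0 <= \sum_i `|v 0 i| by exact: sumr_ge0.
rewrite /euclidean_norm -[leRHS](ger0_norm S0) -sqrtr_sqr ler_sqrt ?sqr_ge0//.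
rewrite expr2 mulr_suml; apply: ler_sum => i _.
rewrite mxE -real_normK ?num_real// expr2 normrM.
have vi : `|v 0 i| * `|(d i)%:R| <= `|v 0 i|.
  by rewrite ler_piMr//; case: (d i); rewrite ?normr1 ?normr0.
apply: ler_pM => //; apply: le_trans vi _.
by rewrite (bigD1 i)//= lerDl sumr_ge0.
Qed.

Section model.
Context (R : realType) (N : nat) (M : dosp_model R N).
Hypothesis hsrc : random_sources M.

Local Notation P := (Pr M).

(** The slot is shifted by one, as slots start at 1. *)
Definition slot_events (x : source N * nat) := source_events M x.2.+1 x.1.

Lemma slot_eventsT x : slot_events x setT.
Proof.
by case: x => -[i|i|i|i||] n; exists setT => //; rewrite preimage_setT setTI.
Qed.

Lemma slot_eventsI x : setI_closed (slot_events x).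
Proof.
by case: x => -[i|i|i|i||] n _ _ [B mB <-] [C mC <-];
  exists (B `&` C); rewrite ?setTI ?preimage_setI //; exact: measurableI.
Qed.

Lemma slot_events_measurable x : slot_events x `<=` measurable.
Proof.
case: hsrc => _ _ _ _ md ml mp me ms mk _ _ _ _ _ _ _ _ _ _ _ _.
case: x => -[i|i|i|i||] n _ [B mB <-].
- by apply: (md i n.+1).
- by apply: (ml i n.+1).
- by apply: (mp i n.+1).
- by apply: (me i n.+1).
- by apply: (ms n.+1).
- by rewrite setTI; exact: mk.
Qed.

(** The outcomes, with the sigma-algebra of all sources but [x]: a random variable
    that does not involve [x] is measurable on this type. *)
Definition others (x : source N * nat) := g_sigma_algebraType (rest slot_events x).

Lemma others_measurableW x d' (T' : measurableType d') (f : Omega M -> T') :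
  measurable_fun setT (f : others x -> T') -> measurable_fun setT f.
Proof. exact/rest_measurable_funW/slot_events_measurable. Qed.

Lemma independent_source d2 (T2 : measurableType d2) (Y : Omega M -> T2) x :
  (forall B, measurable B -> slot_events x (Y @^-1` B)) ->
  independent_pair P (idfun : Omega M -> others x) Y.
Proof.
move=> hY; apply: independent_rest hY; last exact: sources_indep.
- exact: slot_eventsT.
- exact: slot_eventsI.
- exact: slot_events_measurable.
Qed.

Lemma measurable_others x : measurable_fun setT (idfun : Omega M -> others x).
Proof. by move=> _ B mB; rewrite setTI; apply: rest_sigma_measurable mB; exact: slot_events_measurable. Qed.

Lemma others_mean_mul d2 (T2 : measurableType d2) (f : Omega M -> R)
    (Y : Omega M -> T2) (g : T2 -> R) x :
  measurable_fun setT (f : others x -> R) -> measurable_fun setT Y ->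
  measurable_fun setT g ->
  (forall B, measurable B -> slot_events x (Y @^-1` B)) ->
  has_mean P f -> has_mean P (g \o Y) -> has_mean P (fun w => f w * g (Y w)) ->
  \int[P]_w (f w * g (Y w)) = (\int[P]_w f w) * (\int[P]_w g (Y w)).
Proof.
move=> mf mY mg hY sf sg sfg.
exact: (independent_mean_mul (measurable_others (x:=x)) mY (independent_source hY)
  mf mg sf sg sfg).
Qed.

Section slot.
Variable n : nat.
Local Notation k := n.+1.

Lemma measurable_delta x i : (Activity i, n) != x ->
  measurable_fun setT (delta i k : others x -> bool).
Proof. by move=> ix; apply: (rest_measurable_fun ix). Qed.

Lemma measurable_elltilde x i : (Step i, n) != x ->
  measurable_fun setT (elltilde i k : others x -> nat).
Proof. by move=> ix; apply: (rest_measurable_fun ix). Qed.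

Lemma measurable_Phi x i : (Perturbation i, n) != x ->
  measurable_fun setT (Phi i k : others x -> R).
Proof. by move=> ix; apply: (rest_measurable_fun ix). Qed.

Lemma measurable_env x : (Environment _, n) != x ->
  measurable_fun setT (env k : others x -> St M).
Proof. by move=> ix; apply: (rest_measurable_fun ix). Qed.

Lemma measurable_link x ij : (Reception _, n) != x ->
  measurable_fun setT ((fun w => link k w ij) : others x -> bool).
Proof.
move=> ix; apply: (rest_measurable_fun ix) => _ [B mB <-].
by exists [set f | B (f ij)].
Qed.

Lemma measurable_betatilde x i : (Activity i, n) != x -> (Step i, n) != x ->
  measurable_fun setT (betatilde i k : others x -> R).
Proof.
move=> ? ?; apply: measurable_active_step; [exact: measurable_delta|exact: measurable_elltilde].
Qed.

Lemma measurable_gammatilde x i : (Activity i, n) != x -> (Step i, n) != x ->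
  measurable_fun setT (gammatilde i k : others x -> R).
Proof.
move=> ? ?; apply: measurable_active_step; [exact: measurable_delta|exact: measurable_elltilde].
Qed.

Lemma measurable_activity x (h : {ffun 'I_N -> bool} -> R) :
  (forall i, (Activity i, n) != x) ->
  measurable_fun setT ((fun w => h (activity k w)) : others x -> R).
Proof. by move=> ix; apply: measurable_of_ffun_bool => i; exact: measurable_delta. Qed.

Lemma measurable_performed x a i :
  (forall i, (Activity i, n) != x) -> (forall i, (Step i, n) != x) ->
  (forall i, (Perturbation i, n) != x) ->
  measurable_fun setT ((fun w => performed k a w 0 i) : others x -> R).
Proof.
move=> ? ? ?; under eq_fun do rewrite !mxE.
apply: measurable_funD => //; apply: measurable_funM.
  exact: measurable_gammatilde.
exact: measurable_Phi.
Qed.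

End slot.
End model.

(** * Step-sizes, perturbations and utilities at one slot *)

Section dosp.
Context (R : realType) (N : nat) (M : dosp_model R N).
Hypotheses (hsrc : random_sources M) (hutil : regular_utilities M).
Hypothesis hstep : step_parameters M.

Local Notation P := (Pr M).

Lemma fine_expectation (X : Omega M -> R) : fine 'E_P[X] = \int[P]_w X w.
Proof. by rewrite unlock. Qed.

Lemma powRN_range (l : nat) (c : R) : (0 < l)%N -> 0 < c ->
  0 < (l%:R : R) `^ (- c) <= 1.
Proof.
move=> l0 c0; rewrite powR_gt0 ?ltr0n//= powRN invf_le1 ?powR_gt0 ?ltr0n//.
by rewrite -[leLHS](powRr0 (l%:R : R)) ler_powR ?ler1n// ltW.
Qed.

Lemma beta_range l : (0 < l)%N -> 0 < beta M l <= beta0 M.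
Proof.
move=> l0; have [b0 _ /andP[c10 _] _ _] := hstep.
have /andP[p0 p1] : 0 < (l%:R : R) `^ (- c1 M) <= 1.
  by apply: powRN_range => //; lra.
by rewrite /beta mulr_gt0//= ler_piMr// ltW.
Qed.

Lemma gamma_range l : (0 < l)%N -> 0 < gamma M l <= gamma0 M.
Proof.
move=> l0; have [_ g0 _ /andP[c20 _] _] := hstep.
have /andP[p0 p1] : 0 < (l%:R : R) `^ (- c2 M) <= 1 by exact: powRN_range.
by rewrite /gamma mulr_gt0//= ler_piMr// ltW.
Qed.

Lemma betatildeE i k (w : Omega M) :
  betatilde i k w = (delta i k w)%:R * beta M (elltilde i k w).+1.
Proof. by rewrite /betatilde /ell; case: (delta i k w); rewrite ?mul0r// addn1. Qed.

Lemma gammatildeE i k (w : Omega M) :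
  gammatilde i k w = (delta i k w)%:R * gamma M (elltilde i k w).+1.
Proof. by rewrite /gammatilde /ell; case: (delta i k w); rewrite ?mul0r// addn1. Qed.

Lemma betatilde_range i k (w : Omega M) : 0 <= betatilde i k w <= beta0 M.
Proof.
have b0 := beta0_gt0 hstep; rewrite betatildeE.
have /andP[h1 h2] : 0 < beta M (elltilde i k w).+1 <= beta0 M by exact: beta_range.
by case: (delta i k w); rewrite ?mul1r ?mul0r ?lexx ltW ?andbT.
Qed.

Lemma gammatilde_range i k (w : Omega M) : 0 <= gammatilde i k w <= gamma0 M.
Proof.
have b0 := gamma0_gt0 hstep; rewrite gammatildeE.
have /andP[h1 h2] : 0 < gamma M (elltilde i k w).+1 <= gamma0 M by exact: gamma_range.
by case: (delta i k w); rewrite ?mul1r ?mul0r ?lexx ltW ?andbT.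
Qed.

Section slot.
Variable n : nat.
Local Notation k := n.+1.

Lemma measurable_Phi_slot i : measurable_fun setT (@Phi R N M i k).
Proof. by case: hsrc => *; auto. Qed.

Lemma Phi_abs i (w : Omega M) : `|Phi i k w| <= alpha_Phi M.
Proof. exact: Phi_bound. Qed.

Lemma has_mean_Phi i : has_mean P (@Phi R N M i k).
Proof. exact: has_mean_bounded (measurable_Phi_slot i) (Phi_abs i). Qed.

Lemma mean_Phi i : \int[P]_w Phi i k w = 0.
Proof. by rewrite -fine_expectation Phi_mean. Qed.

Lemma mean_Phi_sqr i : \int[P]_w (Phi i k w ^+ 2) = sigma_Phi M ^+ 2.
Proof. by rewrite -fine_expectation Phi_second_moment. Qed.

(** By [`|x| <= 1 + x ^ 2]; the noise and the Lipschitz constant are given by their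
    second moments only. *)
Lemma has_mean_sqr_le (X : Omega M -> R) : measurable_fun setT X ->
  (\int[P]_w (X w ^+ 2)%:E < +oo)%E -> has_mean P X.
Proof.
move=> mX X2; apply: (@has_mean_le _ _ _ _ _ (fun w => 1 + X w ^+ 2)) => //.
  move=> w; rewrite -[X w ^+ 2]real_normK ?num_real//.
  by have := sqr_ge0 (`|X w| - 1); rewrite expr2; nra.
apply: has_meanD; first exact: has_mean_cst.
apply/integrableP; split; first by apply/measurable_EFinP; exact: measurable_funX.
by under eq_integral do rewrite gee0_abs ?lee_fin ?sqr_ge0//.
Qed.

Lemma has_mean_eta i : has_mean P (@eta R N M i k).
Proof.
apply: has_mean_sqr_le; first by case: hsrc => *; auto.
have := eta_variance hsrc i (ltn0Sn n); rewrite /variance unlock eta_mean//=.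
rewrite unlock => e.
suff -> : (\int[P]_w (eta i k w ^+ 2)%:E = (sigma_eta M ^+ 2)%:E)%E by rewrite ltry.
by rewrite -e; apply: eq_integral => w _;
  rewrite expr2 -[RHS]/((eta i k w - 0) * (eta i k w - 0))%:E subr0.
Qed.

Lemma mean_eta i : \int[P]_w eta i k w = 0.
Proof. by rewrite -fine_expectation eta_mean. Qed.

Lemma performed_coord a (w : Omega M) i :
  performed k a w 0 i = a 0 i + gammatilde i k w * Phi i k w.
Proof. by rewrite !mxE. Qed.

(** The performed actions surround [a]: if a coordinate of [a] were outside the
    box, the perturbation would always have to bring it back, hence keep one
    sign and stay away from 0, although its mean is 0. *)
Lemma performable_box a : performable M k a -> box (dmin M) (dmax M) a.
Proof.
move=> ha i; have g0 := gamma0_gt0 hstep.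
have hw (w : Omega M) : dmin M 0 i <= a 0 i + gammatilde i k w * Phi i k w <= dmax M 0 i.
  by rewrite -performed_coord; exact: ha.
have key (c e : R) : 0 < e -> (c = 1 \/ c = -1) ->
    (forall w : Omega M, e <= gammatilde i k w * (c * Phi i k w)) -> False.
  move=> e0 c1 h.
  suff : e / gamma0 M <= \int[P]_w (c * Phi i k w).
    rewrite RintegralZl//; last exact: has_mean_Phi.
    by rewrite mean_Phi mulr0 leNgt divr_gt0.
  rewrite -[leLHS](mean_cst P); apply: le_Rintegral => //.
  - exact: has_mean_cst.
  - by apply: has_meanZ; exact: has_mean_Phi.
  - move=> w _; rewrite ler_pdivrMr//; have := h w.
    move: (c * Phi i k w) (gammatilde_range i k w) => x /andP[gt0 gt1] ex.
    have x0 : 0 < x by rewrite ltNge; apply/negP => x0; nra.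
    by nra.
apply/andP; split; rewrite leNgt; apply/negP => lt.
- apply: (key 1 (dmin M 0 i - a 0 i)); [lra|by left|].
  by move=> w; have := hw w; rewrite mul1r; lra.
- apply: (key (-1) (a 0 i - dmax M 0 i)); [lra|by right|].
  by move=> w; have := hw w; rewrite mulN1r mulrN; lra.
Qed.

Section utilities.
Variable a : 'rV[R]_N.
Hypothesis ha : performable M k a.
Let ba := performable_box ha.

Lemma measurable_env_slot l : (0 < l)%N -> measurable_fun setT (@env R N M l).
Proof. by case: hsrc => *; auto. Qed.

(** A majorant of all utilities on the box, uniform in the action and in the
    activity vector, so that it dominates the utility at a random action. *)
Definition utility_bound (s : St M) : R :=
  \sum_j \sum_d `|u j a d s| + `|lipS s| * \sum_i (dmax M 0 i - dmin M 0 i).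

Lemma utility_le j x d s : box (dmin M) (dmax M) x ->
  `|@u R N M j x d s| <= utility_bound s.
Proof.
move=> bx; have -> : u j x d s = u j a d s + (u j x d s - u j a d s) by ring.
apply: le_trans (ler_normD _ _) _; apply: lerD.
  rewrite (bigD1 j)//= (bigD1 d)//= -!addrA lerDl addr_ge0 ?sumr_ge0// => i _.
  exact: sumr_ge0.
apply: le_trans (u_lipschitz hutil j d s bx ba) _.
apply: (@le_trans _ _ (`|lipS s| * euclidean_norm (mask d (x - a)))).
  by apply: ler_wpM2r; [exact: sqrtr_ge0|exact: ler_norm].
apply: ler_wpM2l => //; apply: le_trans (euclidean_norm_mask_le _ _) _.
apply: ler_sum => i _; rewrite !mxE.
by have := bx i; have := ba i; rewrite ler_norml; lra.
Qed.

Lemma has_mean_env (h : St M -> R) l : (0 < l)%N -> measurable_fun setT h ->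
  has_mean P (h \o env 1) ->
  has_mean P (h \o env l) /\ \int[P]_w h (env l w) = \int[P]_w h (env 1 w).
Proof.
move=> l0 mh; apply: same_law_mean => //; try exact: measurable_env_slot.
by move=> B mB; rewrite [RHS]env_law.
Qed.

Lemma measurable_utility_bound : measurable_fun setT utility_bound.
Proof.
apply: measurable_funD; last first.
  by apply: measurable_funM => //; apply: measurableT_comp => //; exact: lipS_meas.
apply: measurable_sum => j; apply: measurable_sum => d.
by apply: measurableT_comp => //; exact: u_meas.
Qed.

Lemma has_mean_utility_bound l : (0 < l)%N -> has_mean P (utility_bound \o env l).
Proof.
move=> l0; have [] := @has_mean_env utility_bound l l0 measurable_utility_bound => //.
apply: has_meanD.
  apply: has_mean_sum => j; apply: has_mean_sum => d; apply: has_mean_norm.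
  exact: u_integrable.
under eq_fun do rewrite mulrC; apply: has_meanZ; apply: has_mean_norm.
apply: has_mean_sqr_le.
  by apply: measurableT_comp; [exact: lipS_meas|exact: measurable_env_slot].
by have := lipS_second_moment hutil; rewrite unlock.
Qed.

Lemma measurable_utility x j :
  (forall i, (Activity i, n) != x) -> (forall i, (Step i, n) != x) ->
  (forall i, (Perturbation i, n) != x) ->
  measurable_fun setT (fun z : others M x * St M =>
    u j (performed k a z.1) (activity k z.1) z.2).
Proof.
move=> hA hS hP.
rewrite (_ : (fun z => _) = fun z : others M x * St M =>
  \sum_d (activity k z.1 == d)%:R * u j (performed k a z.1) d z.2); last first.
  by apply/funext => z; rewrite [LHS](ffun_bool_expand (fun d => u j _ d _)).
apply: measurable_sum => d; apply: measurable_funM.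
  apply: (measurableT_comp (f := (fun w => (activity k w == d)%:R) : others M x -> R)) => //.
  exact: (measurable_activity (fun c => (c == d)%:R) hA).
have mp i : measurable_fun setT ((fun w => performed k a w 0 i) : others M x -> R).
  exact: measurable_performed.
have mv b : box (dmin M) (dmax M) b -> measurable_fun setT (@u R N M j b d).
  by move=> bb; exact: u_meas.
apply: (measurable_lipschitz_param mp ha mv (L := fun s => `|lipS s|)).
move=> b b' s bb bb'; apply: le_trans (u_lipschitz hutil j d s bb bb') _.
apply: (@le_trans _ _ (`|lipS s| * euclidean_norm (mask d (b - b')))).
  by apply: ler_wpM2r; [exact: sqrtr_ge0|exact: ler_norm].
apply: ler_wpM2l => //; apply: le_trans (euclidean_norm_mask_le _ _) _.
by apply: ler_sum => i _; rewrite !mxE.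
Qed.

End utilities.
End slot.
End dosp.

(** * Averaging out noise, receptions and environment *)

Section averaging.
Context (R : realType) (N : nat) (M : dosp_model R N).
Hypotheses (hsrc : random_sources M) (hutil : regular_utilities M).
Hypothesis hstep : step_parameters M.
Variables (n : nat) (a : 'rV[R]_N).
Hypothesis ha : performable M n.+1 a.

Local Notation P := (Pr M).
Local Notation k := n.+1.
Local Notation U j w := (u j (performed k a w) (activity k w) (env k w)).
Local Notation bPhi i w := (betatilde i k w * Phi i k w).

Lemma measurable_bPhi x i : (Activity i, n) != x -> (Step i, n) != x ->
  (Perturbation i, n) != x ->
  measurable_fun setT ((fun w => bPhi i w) : others M x -> R).
Proof.
move=> ? ? ?; apply: measurable_funM; last exact: measurable_Phi.
exact: measurable_betatilde.
Qed.

Lemma bPhi_abs i (w : Omega M) : `|bPhi i w| <= beta0 M * alpha_Phi M.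
Proof.
have /andP[b0 b1] := betatilde_range hstep i k w.
by rewrite normrM ger0_norm// ler_pM//; exact: Phi_abs.
Qed.

Lemma measurable_U x j : (Environment _, n) != x ->
  (forall i, (Activity i, n) != x) -> (forall i, (Step i, n) != x) ->
  (forall i, (Perturbation i, n) != x) ->
  measurable_fun setT ((fun w => U j w) : others M x -> R).
Proof.
move=> hE hA hS hP.
have mid : measurable_fun setT ((fun w => (w, env k w)) : others M x -> others M x * St M).
  by apply: measurable_fun_pair => //; exact: measurable_env.
exact: (measurableT_comp (measurable_utility hutil ha j hA hS hP) mid).
Qed.

Lemma has_mean_U j : has_mean P (fun w => U j w).
Proof.
apply: (has_mean_le _ _ (has_mean_utility_bound hsrc hutil hstep ha (ltn0Sn n))).
  by apply: (others_measurableW hsrc (x := (Reception _, n))); apply: measurable_U; distinct_sources.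
by move=> w; exact: (utility_le hsrc hutil hstep ha).
Qed.

Lemma has_mean_bPhi_mul i (X : Omega M -> R) : has_mean P X ->
  has_mean P (fun w => bPhi i w * X w).
Proof.
apply: has_mean_mul_bounded (bPhi_abs i).
by apply: (others_measurableW hsrc (x := (Reception _, n))); apply: measurable_bPhi; distinct_sources.
Qed.

Lemma U_inactive j (w : Omega M) : ~~ delta j k w -> U j w = 0.
Proof. by move=> dj; apply: (u_inactive hutil) => //; rewrite ffunE. Qed.

Lemma noise_averages_out j (c : Omega M -> R) C :
  measurable_fun setT (c : others M (Noise j, n) -> R) ->
  (forall w, `|c w| <= C) ->
  has_mean P (fun w => c w * eta j k w) /\ \int[P]_w (c w * eta j k w) = 0.
Proof.
move=> mc cC; have mc' := others_measurableW hsrc mc.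
have sc : has_mean P (fun w => c w * eta j k w).
  by apply: has_mean_mul_bounded mc' cC _; exact: has_mean_eta.
split => //.
have := others_mean_mul hsrc mc (has_mean_measurable (has_mean_eta hsrc n j))
   (@measurable_id _ R setT) _ (has_mean_bounded P mc' cC) (has_mean_eta hsrc n j) sc.
rewrite mean_eta// mulr0; apply => B mB; exists B => //.
by rewrite setTI.
Qed.

Lemma reception_average i j (X : Omega M -> R) : j != i ->
  measurable_fun setT (X : others M (Reception _, n) -> R) -> has_mean P X ->
  has_mean P (fun w => X w * (link k w (i, j))%:R) /\
  \int[P]_w (X w * (link k w (i, j))%:R) = qr M * \int[P]_w X w.
Proof.
move=> ji mX sX.
have ml : measurable_fun setT (fun w : Omega M => link k w (i, j)).
  by apply: (others_measurableW hsrc (x := (Environment _, n))); apply: measurable_link; distinct_sources.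
have mlr := measurable_bool_natr (R := R) ml.
have sl : has_mean P (fun w => (link k w (i, j))%:R).
  by apply: (has_mean_bounded P mlr (c := 1)) => w; exact: normr_bool_le1.
have sXl : has_mean P (fun w => X w * (link k w (i, j))%:R).
  under eq_fun do rewrite mulrC.
  apply: (has_mean_mul_bounded mlr (c := 1)) => // w.
  exact: normr_bool_le1.
split => //.
have mb : measurable_fun setT (fun b : bool => b%:R : R) by [].
rewrite (others_mean_mul hsrc mX ml mb _ sX sl sXl).
  rewrite mulrC; congr (_ * _); rewrite mean_bool; first by rewrite link_law.
  by rewrite -[X in measurable X]setTI; exact: (ml measurableT [set true]).
move=> B mB; exists [set f | B (f (i, j))] => //.
by rewrite setTI.
Qed.

(** The indicator of [delta j] is split off in the noise terms only: in the
    utility terms it is redundant, as inactive nodes have utility 0. *)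
Lemma ghatE i (w : Omega M) : ghat i k a w =
  bPhi i w * U i w + bPhi i w * eta i k w +
  \sum_(j | j != i) ((qr M)^-1 * (bPhi i w * U j w * (link k w (i, j))%:R) +
    (qr M)^-1 * (bPhi i w * (delta j k w)%:R * (link k w (i, j))%:R * eta j k w)).
Proof.
rewrite /ghat /ftilde mulrDr {1}/utilde mulrDr; congr (_ + _).
rewrite mulrCA !mulr_sumr [RHS]big_mkcond [LHS]big_mkcond /=.
apply: eq_bigr => j _; rewrite !inE; case: eqVneq => [->|ji] //=.
rewrite /utilde; have [dj|dj] := boolP (delta j k w); last first.
  by rewrite U_inactive// !(mulr0, mul0r) addr0.
by case: (link k w (i, j)) => /=; rewrite ?(mulr1, mulr0, mul0r, addr0)//; ring.
Qed.

(** The factor [1 / qr] compensates for the probability of a reception, so the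
    partial sum that a node receives stands for the full sum of utilities. *)
Lemma gbar_utilities i :
  gbar M i k a = \int[P]_w (bPhi i w * \sum_j U j w).
Proof.
rewrite /gbar fine_expectation; under eq_Rintegral do rewrite ghatE.
have sbU j : has_mean P (fun w => bPhi i w * U j w).
  by apply: has_mean_bPhi_mul; exact: has_mean_U.
have [sbe be] : has_mean P (fun w => bPhi i w * eta i k w) /\
    \int[P]_w (bPhi i w * eta i k w) = 0.
  by apply: (noise_averages_out _ (bPhi_abs i)); apply: measurable_bPhi; distinct_sources.
have L j : j != i -> has_mean P (fun w => bPhi i w * U j w * (link k w (i, j))%:R) /\
    \int[P]_w (bPhi i w * U j w * (link k w (i, j))%:R) =
    qr M * \int[P]_w (bPhi i w * U j w).
  move=> ji; apply: reception_average => //.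
  by apply: measurable_funM; [apply: measurable_bPhi|apply: measurable_U]; distinct_sources.
have E j : has_mean P (fun w =>
      bPhi i w * (delta j k w)%:R * (link k w (i, j))%:R * eta j k w) /\
    \int[P]_w (bPhi i w * (delta j k w)%:R * (link k w (i, j))%:R * eta j k w) = 0.
  apply: (@noise_averages_out _ _ (beta0 M * alpha_Phi M)).
    apply: measurable_funM; last first.
      by apply: measurable_bool_natr; apply: measurable_link; distinct_sources.
    apply: measurable_funM; first by apply: measurable_bPhi; distinct_sources.
    by apply: measurable_bool_natr; apply: measurable_delta; distinct_sources.
  move=> w; rewrite -mulrA normrM; apply: le_trans (bPhi_abs i w).
  by rewrite ler_piMr// -natrM mulnb normr_bool_le1.
have sL j : has_mean P (fun w => if j != i then
    (qr M)^-1 * (bPhi i w * U j w * (link k w (i, j))%:R) +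
    (qr M)^-1 * (bPhi i w * (delta j k w)%:R * (link k w (i, j))%:R * eta j k w) else 0).
  case: (boolP (j != i)) => ji; last exact: has_mean_cst.
  by apply: has_meanD; apply: has_meanZ; [exact: (L j ji).1|exact: (E j).1].
under eq_Rintegral do rewrite [X in _ + X]big_mkcond /=.
rewrite RintegralD//; [|exact: has_meanD|exact: has_mean_sum].
have -> : \int[P]_w (bPhi i w * U i w + bPhi i w * eta i k w) =
    \int[P]_w (bPhi i w * U i w).
  by rewrite (RintegralD _ (sbU i) sbe)// be addr0.
rewrite mean_sum//.
under [RHS]eq_Rintegral do rewrite mulr_sumr.
rewrite mean_sum// [RHS](bigD1 i)//=; congr (_ + _).
rewrite [RHS]big_mkcond; apply: eq_bigr => j _; case: (boolP (j != i)) => ji; last exact: mean_cst.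
have [[sL1 L1] [sE1 E1]] := (L j ji, E j).
have q0 : qr M != 0 by rewrite gt_eqF//; case/andP: (qr_range hsrc).
rewrite RintegralD//; [|exact: has_meanZ|exact: has_meanZ].
by rewrite RintegralZl// RintegralZl// L1 E1 mulr0 addr0 mulKf.
Qed.

Lemma G_mean d x l : (0 < l)%N -> box (dmin M) (dmax M) x ->
  has_mean P (fun w => \sum_j u j x d (env l w)) /\
  G M d x = \int[P]_w (\sum_j u j x d (env l w)).
Proof.
move=> l0 bx.
have mu : measurable_fun setT (fun s => \sum_j @u R N M j x d s).
  by apply: measurable_sum => j; exact: u_meas.
have su : has_mean P (fun w => \sum_j u j x d (env 1 w)).
  by apply: has_mean_sum => j; exact: u_integrable.
have [s1 e1] := has_mean_env hsrc l0 mu su; split => //.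
rewrite e1 /G fine_expectation; apply: eq_Rintegral => w _.
rewrite /utot [LHS]big_mkcond; apply: eq_bigr => j _; case: ifPn => // dj.
by rewrite (u_inactive hutil).
Qed.

(** The environment is independent of the activity, the step-sizes and the
    perturbations, so it can be averaged first, at a fixed performed action. *)
Lemma gbar_G i :
  has_mean P (fun w => bPhi i w * G M (activity k w) (performed k a w)) /\
  gbar M i k a = \int[P]_w (bPhi i w * G M (activity k w) (performed k a w)).
Proof.
pose x : source N * nat := (Environment _, n).
pose f (z : others M x * St M) := bPhi i z.1 *
  \sum_j u j (performed k a z.1) (activity k z.1) z.2.
have mf : measurable_fun setT f.
  apply: measurable_funM.
    apply: (measurableT_comp (f := (fun w => bPhi i w) : others M x -> R)) => //.
    apply: measurable_bPhi; distinct_sources.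
  by apply: measurable_sum => j; apply: measurable_utility => //; distinct_sources.
have menv := measurable_env_slot hsrc (ltn0Sn n).
have iE : independent_pair P (idfun : Omega M -> others M x) (env k).
  by apply: independent_source => // B mB; exists B => //; rewrite setTI.
have sf : has_mean P (fun w => f (w, env k w)).
  by apply: has_mean_bPhi_mul; apply: has_mean_sum => j; exact: has_mean_U.
have sw (w : Omega M) : has_mean P (fun w' => \sum_j u j (performed k a w) (activity k w) (env k w')).
  by have [] := G_mean (activity k w) (ltn0Sn n) (ha w).
have fG (w : Omega M) : \int[P]_w' f (w, env k w') =
    bPhi i w * G M (activity k w) (performed k a w).
  rewrite /f /= (RintegralZl _ _ (sw w))//; congr (_ * _).
  by have [_ ->] := G_mean (activity k w) (ltn0Sn n) (ha w).
have [|sF fE] := independent_Fubini (measurable_others hsrc (x := x)) menv iE mf sf.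
  by move=> w; exact: (has_meanZ (bPhi i w) (sw w)).
split; first by move: sF; congr integrable; apply/funext => w; rewrite -fG.
rewrite gbar_utilities; transitivity (\int[P]_w \int[P]_w' f (w, env k w')) => //.
by apply: eq_Rintegral => w _; rewrite fG.
Qed.

End averaging.

(** * Gradient of the mean utility *)

Section activity_law.
Context (R : realType) (N : nat) (M : dosp_model R N).
Hypothesis hsrc : random_sources M.
Local Notation P := (Pr M).

Definition activity_weight (d : {ffun 'I_N -> bool}) : R :=
  \prod_i (if d i then qa M else 1 - qa M).

Lemma probability_delta i n (b : bool) :
  fine (P [set w | delta i n.+1 w = b]) = if b then qa M else 1 - qa M.
Proof.
case: b; first by have := delta_law hsrc i (ltn0Sn n) => /= ->.
have -> : [set w | delta i n.+1 w = false] = ~` [set w : Omega M | delta i n.+1 w].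
  by apply/seteqP; split => w /=; [move=> ->|move/negP/negbTE].
rewrite probability_setC; first by rewrite delta_law.
have := delta_meas hsrc i (ltn0Sn n) => /(_ measurableT [set true] I).
by rewrite setTI.
Qed.

Lemma mean_activity_eq n d :
  \int[P]_w (activity n.+1 w == d)%:R = activity_weight d.
Proof.
have mA : measurable [set w : Omega M | activity n.+1 w == d].
  have := @measurable_activity _ _ M n (Environment _, n) (fun c => (c == d)%:R).
  move=> /(_ _)/(others_measurableW hsrc) h.
  have {}h : measurable_fun setT (fun w : Omega M => (activity n.+1 w == d)%:R : R).
    by apply: h; distinct_sources.
  have := h measurableT [set 1] (measurable_set1 _); rewrite setTI.
  congr measurable; apply/seteqP; split => w /=; first by case: eqP => // _ /eqP; rewrite eq_sym oner_eq0.
  by move=> ->.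
rewrite mean_bool//.
pose s := [seq (@Activity N i, n) | i <- enum 'I_N].
pose A (x : source N * nat) : set (Omega M) :=
  if x.1 is Activity i then [set w | delta i x.2.+1 w = d i] else setT.
have := sources_indep hsrc (s := s).
have us : uniq s by rewrite map_inj_uniq ?enum_uniq// => i j [].
move=> /(_ us A) h.
have -> : [set w | activity n.+1 w == d] = \bigcap_(x in [set` s]) A x.
  apply/seteqP; split => w /=.
    by move/eqP => de _ /= /mapP[i _ ->]; rewrite /A /= -de ffunE.
  move=> h'; apply/eqP/ffunP => i; rewrite ffunE.
  have /h' : (@Activity N i, n) \in s by apply: map_f; rewrite mem_enum.
  by [].
rewrite h /=; last first.
  move=> x /mapP[i _ ->]; rewrite /A /=; exists [set d i] => //.
  by rewrite setTI.
rewrite /s big_map /activity_weight big_enum /=; apply: eq_bigr => i _.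
exact: probability_delta.
Qed.

Lemma has_mean_activity n (h : {ffun 'I_N -> bool} -> R) :
  has_mean P (fun w => h (activity n.+1 w)).
Proof.
have mh := others_measurableW hsrc
  (@measurable_activity _ _ M n (Environment _, n) h ltac:(distinct_sources)).
apply: (has_mean_bounded P mh (c := \sum_d `|h d|)) => w.
by rewrite (bigD1 (activity n.+1 w))//= lerDl sumr_ge0.
Qed.

Lemma mean_activity n (h : {ffun 'I_N -> bool} -> R) :
  \int[P]_w h (activity n.+1 w) = \sum_d activity_weight d * h d.
Proof.
under eq_Rintegral do rewrite (ffun_bool_expand h).
have s1 d : has_mean P (fun w => (activity n.+1 w == d)%:R).
  exact: (has_mean_activity n (fun c => (c == d)%:R)).
have s2 d : has_mean P (fun w => (activity n.+1 w == d)%:R * h d).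
  exact: (has_mean_activity n (fun c => (c == d)%:R * h d)).
rewrite mean_sum//; apply: eq_bigr => d _.
by rewrite (RintegralZr _ _ (s1 d))// mean_activity_eq.
Qed.

End activity_law.

Section gradient.
Context (R : realType) (N : nat) (M : dosp_model R N).
Hypotheses (hsrc : random_sources M) (hutil : regular_utilities M).
Local Notation P := (Pr M).

(** The identity is known only on the box where the utilities are regular, which is
    why derivatives are compared from inside the box afterwards. *)
Lemma F_G (x : 'rV[R]_N) : box (dmin M) (dmax M) x ->
  F M x = \sum_d activity_weight M d * G M d x.
Proof.
move=> bx; rewrite /F fine_expectation.
pose V d (s : St M) : R := \sum_j u j x d s.
have mV d : measurable_fun setT (V d).
  by apply: measurable_sum => j; exact: u_meas.
have sV d : has_mean P (fun w => V d (env 1 w)).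
  by apply: has_mean_sum => j; exact: u_integrable.
have UV d s : utot x d s = V d s.
  rewrite /utot big_mkcond; apply: eq_bigr => j _; case: ifPn => // dj.
  by rewrite (u_inactive hutil).
have GV d : G M d x = \int[P]_w V d (env 1 w).
  by rewrite /G fine_expectation; apply: eq_Rintegral => w _; rewrite UV.
under eq_Rintegral => w _.
  rewrite UV (ffun_bool_expand (fun d => V d (env 1 w))).
  over.
have mact d : measurable_fun setT
    ((fun w => (activity 1 w == d)%:R) : others M (Environment _, 0%N) -> R).
  by apply: (measurable_activity (n := 0) (fun c => (c == d)%:R)); distinct_sources.
have sp d : has_mean P (fun w => (activity 1 w == d)%:R * V d (env 1 w)).
  apply: (has_mean_mul_bounded (others_measurableW hsrc (mact d)) (c := 1)) => // w.
  exact: normr_bool_le1.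
rewrite mean_sum//; apply: eq_bigr => d _.
have menv := measurable_env_slot hsrc (ltn0Sn 0).
rewrite (others_mean_mul hsrc (mact d) menv (mV d) _ _ (sV d) (sp d)).
- by rewrite mean_activity_eq// GV.
- by move=> B mB; exists B => //; rewrite setTI.
- exact: (has_mean_activity hsrc 0 (fun c => (c == d)%:R)).
Qed.

Lemma box_nondegenerate i : dmin M 0 i < dmax M 0 i.
Proof.
have lo j : amin M 0 j <= amax M 0 j.
  by have /andP[] := astar_interior hutil j; lra.
have b1 : box (amin M) (amax M) (amin M) by move=> j; rewrite lexx lo.
have b2 : box (amin M) (amax M) (amax M) by move=> j; rewrite lexx lo.
have /andP[h1 _] := box_sub hutil b1 i.
have /andP[_ h2] := box_sub hutil b2 i.
by have /andP[] := astar_interior hutil i; lra.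
Qed.

Lemma differentiable_weighted_sum (I : Type) (r : seq I) (p : I -> R)
    (g : I -> 'rV[R]_N -> R) (x : 'rV[R]_N) i :
  (forall d, differentiable (g d) x) ->
  differentiable (fun y => \sum_(d <- r) p d * g d y) x /\
  partial i (fun y => \sum_(d <- r) p d * g d y) x =
    \sum_(d <- r) p d * partial i (g d) x.
Proof.
move=> dg; elim: r => [|d r [IH1 IH2]].
  have -> : (fun y => \sum_(d <- [::]) p d * g d y) = cst 0.
    by apply/funext => y; rewrite big_nil.
  by split; [exact: differentiable_cst|rewrite /partial derive_cst big_nil].
have -> : (fun y => \sum_(d <- d :: r) p d * g d y) =
    (p d *: g d) + (fun y => \sum_(d <- r) p d * g d y).
  by apply/funext => y; rewrite big_cons.
have dd : differentiable (p d *: g d) x by exact: differentiableZ.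
split; first exact: differentiableD.
rewrite /partial deriveD; [|exact: diff_derivable|exact: diff_derivable].
by rewrite big_cons deriveZ; [rewrite -IH2|exact: diff_derivable].
Qed.

Section point.
Variables (a : 'rV[R]_N) (i : 'I_N).
Hypothesis ba : box (dmin M) (dmax M) a.

Lemma partial_F : partial i (F M) a =
  \sum_d activity_weight M d * partial i (G M d) a.
Proof.
have dG d : differentiable (G M d) a by have [] := G_twice_diff hutil d ba.
have [d1 <-] := differentiable_weighted_sum
  (index_enum {ffun 'I_N -> bool}) (activity_weight M) i dG.
have [dF _] := F_twice_diff hutil ba.
apply: (eq_partial_box (box_nondegenerate i) ba dF d1) => t bt.
exact: F_G.
Qed.

(** The Lipschitz condition only sees the active coordinates, so [G M d] is
    constant in the direction of an inactive node. *)
Lemma partial_G_inactive (d : {ffun 'I_N -> bool}) : ~~ d i -> partial i (G M d) a = 0.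
Proof.
move=> di; have [dG _] := G_twice_diff hutil d ba.
have -> : 0 = partial i (cst (G M d a)) a by rewrite /partial derive_cst.
apply: (eq_partial_box (box_nondegenerate i) ba dG) => // t bt.
rewrite /G /cst; congr (fine (expectation _ _)); apply/funext => w.
apply: eq_bigr => j _.
have := u_lipschitz hutil j d (env 1 w) bt ba.
suff -> : mask d (a + t *: delta_mx 0 i - a) = 0.
  have -> : euclidean_norm (0 : 'rV[R]_N) = 0.
    by rewrite /euclidean_norm big1 ?sqrtr0// => l _; rewrite mxE expr0n.
  by rewrite mulr0 normr_le0 subr_eq0 => /eqP.
apply/rowP => l; rewrite !mxE eqxx /=; case: eqVneq => [->|_].
  by rewrite (negbTE di) mulr0.
by rewrite mulr0 addr0 subrr mul0r.
Qed.

Lemma mean_active_partial_G n :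
  \int[P]_w ((delta i n.+1 w)%:R * partial i (G M (activity n.+1 w)) a) =
  partial i (F M) a.
Proof.
rewrite partial_F -(mean_activity hsrc n); apply: eq_Rintegral => w _.
have [di|di] := boolP (delta i n.+1 w); first by rewrite mul1r.
by rewrite mul0r partial_G_inactive// ffunE.
Qed.

End point.
End gradient.

(** * Expansion of the averaged update *)

Section bias_bound.
Context (R : realType) (N : nat) (M : dosp_model R N).
Hypotheses (hsrc : random_sources M) (hutil : regular_utilities M).
Hypothesis hstep : step_parameters M.
Local Notation P := (Pr M).

Section steps.
Variables (n : nat) (i : 'I_N).
Local Notation k := n.+1.

Definition mean_step : R :=
  \int[P]_w (beta M (elltilde i k w).+1 * gamma M (elltilde i k w).+1).

Lemma step_product_bound (m : nat) :
  `|beta M m.+1 * gamma M m.+1| <= beta0 M * gamma0 M.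
Proof.
have /andP[b0 b1] : 0 < beta M m.+1 <= beta0 M by exact: beta_range.
have /andP[g0 g1] : 0 < gamma M m.+1 <= gamma0 M by exact: gamma_range.
have [b2 g2] := (ltW b0, ltW g0).
by rewrite ger0_norm; [apply: ler_pM|apply: mulr_ge0].
Qed.

Lemma measurable_elltilde_slot : measurable_fun setT (@elltilde R N M i k).
Proof. by case: hsrc => *; auto. Qed.

Lemma has_mean_step : has_mean P
  (fun w => beta M (elltilde i k w).+1 * gamma M (elltilde i k w).+1).
Proof.
apply: (has_mean_bounded P (c := beta0 M * gamma0 M)).
  by apply: (measurableT_comp (f := fun m : nat => beta M m.+1 * gamma M m.+1));
    last exact: measurable_elltilde_slot.
by move=> w; exact: step_product_bound.
Qed.

(** An active node uses the counter [elltilde + 1], and [elltilde] is independent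
    of all activities; this separates the step-sizes from the gradient, although
    both depend on [delta i]. *)
Lemma mean_step_factor (X : Omega M -> R) C :
  measurable_fun setT (X : others M (Step i, n) -> R) ->
  (forall w, `|X w| <= C) ->
  \int[P]_w (betatilde i k w * gammatilde i k w * X w) =
  mean_step * \int[P]_w ((delta i k w)%:R * X w).
Proof.
move=> mX XC.
have mdX : measurable_fun setT
    ((fun w => (delta i k w)%:R * X w) : others M (Step i, n) -> R).
  apply: measurable_funM => //; apply: measurable_bool_natr.
  by apply: measurable_delta; distinct_sources.
have dXC (w : Omega M) : `|(delta i k w)%:R * X w| <= C.
  rewrite normrM (le_trans _ (XC w))// ler_piMl//; exact: normr_bool_le1.
have sdX := has_mean_bounded P (others_measurableW hsrc mdX) dXC.
have sprod := has_mean_mul_bounded (others_measurableW hsrc mdX) dXC has_mean_step.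
have E := others_mean_mul (g := fun m : nat => beta M m.+1 * gamma M m.+1)
  hsrc mdX measurable_elltilde_slot _ _ sdX has_mean_step sprod.
rewrite mulrC -E//.
- apply: eq_Rintegral => w _; rewrite betatildeE gammatildeE.
  by case: (delta i k w); rewrite ?mul1r ?mul0r// mulrC.
- by move=> B mB; exists B => //; rewrite setTI.
Qed.

Lemma betagammaE : betagamma M i k = qa M * mean_step.
Proof.
have m1 : measurable_fun setT ((fun=> 1) : others M (Step i, n) -> R) by [].
have b1 (w : Omega M) : `|1 : R| <= 1 by rewrite normr1.
have := mean_step_factor m1 b1.
under eq_Rintegral do rewrite mulr1.
under [X in _ = _ * X -> _]eq_Rintegral do rewrite mulr1.
rewrite /betagamma fine_expectation => ->; rewrite mulrC; congr (_ * _).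
rewrite mean_bool; first by rewrite delta_law.
have := delta_meas hsrc i (ltn0Sn n) => /(_ measurableT [set true] I).
by rewrite setTI.
Qed.

(** Used with [g] the identity, whose mean is 0, and with [g] the square. *)
Lemma mean_Phi_mul (c : Omega M -> R) C (g : R -> R) :
  measurable_fun setT (c : others M (Perturbation i, n) -> R) ->
  (forall w, `|c w| <= C) -> measurable_fun setT g ->
  has_mean P (fun w => g (Phi i k w)) ->
  \int[P]_w (c w * g (Phi i k w)) = (\int[P]_w c w) * \int[P]_w g (Phi i k w).
Proof.
move=> mc cC mg sg; have mc' := others_measurableW hsrc mc.
apply: (others_mean_mul hsrc mc (measurable_Phi_slot hsrc n i) mg _
  (has_mean_bounded P mc' cC) sg (has_mean_mul_bounded mc' cC sg)).
by move=> B mB; exists B => //; rewrite setTI.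
Qed.

End steps.

Section point.
Variables (n : nat) (a : 'rV[R]_N).
Hypothesis ha : performable M n.+1 a.
Local Notation k := n.+1.
Local Notation bPhi i w := (betatilde i k w * Phi i k w).
Local Notation D j w := (partial j (G M (activity k w)) a).
Let ba : box (dmin M) (dmax M) a := performable_box hsrc hstep ha.

Lemma bounded_betatilde i (w : Omega M) : `|betatilde i k w| <= beta0 M.
Proof. by have /andP[b0 b1] := betatilde_range hstep i k w; rewrite ger0_norm. Qed.

Lemma bounded_gammatilde i (w : Omega M) : `|gammatilde i k w| <= gamma0 M.
Proof. by have /andP[b0 b1] := gammatilde_range hstep i k w; rewrite ger0_norm. Qed.

Lemma bounded_activity (h : {ffun 'I_N -> bool} -> R) (w : Omega M) :
  `|h (activity k w)| <= \sum_d `|h d|.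
Proof. by rewrite (bigD1 (activity k w))//= lerDl sumr_ge0. Qed.

Lemma mean_value_term i :
  has_mean P (fun w => bPhi i w * G M (activity k w) a) /\
  \int[P]_w (bPhi i w * G M (activity k w) a) = 0.
Proof.
split.
  apply: (has_mean_bPhi_mul hsrc hstep).
  exact: (has_mean_activity hsrc n (fun d => G M d a)).
under eq_Rintegral do rewrite mulrAC.
pose c (w : Omega M) := betatilde i k w * G M (activity k w) a.
have mc : measurable_fun setT (c : others M (Perturbation i, n) -> R).
  apply: measurable_funM.
    by apply: measurable_betatilde; distinct_sources.
  by apply: (measurable_activity (fun d => G M d a)); distinct_sources.
rewrite (mean_Phi_mul mc (C := beta0 M * \sum_d `|G M d a|) (g := id))//.
- by rewrite mean_Phi// mulr0.
- move=> w; rewrite normrM ler_pM//; first exact: bounded_betatilde.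
  exact: (bounded_activity (fun d => G M d a)).
- exact: has_mean_Phi.
Qed.

(** For [j != i] the factor [Phi i] is centered and independent of everything else.
    For [j = i] it occurs squared and contributes [sigma_Phi ^ 2]. *)
Lemma mean_gradient_term i j :
  has_mean P (fun w => bPhi i w * (gammatilde j k w * Phi j k w * D j w)) /\
  \int[P]_w (bPhi i w * (gammatilde j k w * Phi j k w * D j w)) =
  if j == i then sigma_Phi M ^+ 2 * mean_step n i * partial i (F M) a else 0.
Proof.
pose dj := fun d => partial j (G M d) a.
have mgD x : (forall i, (Activity i, n) != x) -> (Step j, n) != x ->
    measurable_fun setT ((fun w => gammatilde j k w * D j w) : others M x -> R).
  move=> hA hS; apply: measurable_funM; first exact: measurable_gammatilde.
  exact: (measurable_activity dj).
have gDb (w : Omega M) : `|gammatilde j k w * D j w| <= gamma0 M * \sum_d `|dj d|.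
  rewrite normrM ler_pM//; first exact: bounded_gammatilde.
  exact: (bounded_activity dj).
have mPgD x : (forall i, (Activity i, n) != x) -> (Step j, n) != x ->
    (Perturbation j, n) != x -> measurable_fun setT
    ((fun w => gammatilde j k w * Phi j k w * D j w) : others M x -> R).
  move=> hA hS hP; under eq_fun do rewrite mulrAC.
  by apply: measurable_funM; [exact: mgD|exact: measurable_Phi].
have PgDb (w : Omega M) : `|gammatilde j k w * Phi j k w * D j w| <=
    gamma0 M * (\sum_d `|dj d|) * alpha_Phi M.
  by rewrite mulrAC normrM; apply: ler_pM => //; exact: Phi_abs.
split.
  apply: (has_mean_bPhi_mul hsrc hstep); apply: has_mean_bounded PgDb.
  by apply: (others_measurableW hsrc (x := (Environment _, n))); apply: mPgD; distinct_sources.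
case: eqVneq => [ji|ji].
  subst j.
  have bE (w : Omega M) : bPhi i w * (gammatilde i k w * Phi i k w * D i w) =
    betatilde i k w * (gammatilde i k w * D i w) * Phi i k w ^+ 2 by ring.
  under eq_Rintegral do rewrite bE.
  pose c (w : Omega M) := betatilde i k w * (gammatilde i k w * D i w).
  have mc x : (forall i, (Activity i, n) != x) -> (Step i, n) != x ->
      measurable_fun setT (c : others M x -> R).
    by move=> hA hS; apply: measurable_funM; [exact: measurable_betatilde|exact: mgD].
  have cb (w : Omega M) : `|c w| <= beta0 M * (gamma0 M * \sum_d `|dj d|).
    by rewrite normrM ler_pM//; exact: bounded_betatilde.
  have mcP : measurable_fun setT (c : others M (Perturbation i, n) -> R).
    by apply: mc; distinct_sources.
  rewrite (mean_Phi_mul mcP cb (g := fun x => x ^+ 2)).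
  - rewrite mean_Phi_sqr// mulrC -mulrA; congr (_ * _).
    under eq_Rintegral do rewrite /c mulrA.
    have mD : measurable_fun setT ((fun w => D i w) : others M (Step i, n) -> R).
      by apply: (measurable_activity dj); distinct_sources.
    rewrite (mean_step_factor mD (bounded_activity dj)).
    by rewrite (mean_active_partial_G hsrc hutil i ba n).
  - exact: measurable_funX.
  - apply: (has_mean_bounded P (c := alpha_Phi M ^+ 2)).
      by apply: measurable_funX; exact: measurable_Phi_slot.
    by move=> w; rewrite normrX lerXn2r ?nnegrE ?Phi_abs// ltW// alpha_Phi_gt0.
under eq_Rintegral do rewrite mulrAC.
pose c (w : Omega M) := betatilde i k w * (gammatilde j k w * Phi j k w * D j w).
have mc : measurable_fun setT (c : others M (Perturbation i, n) -> R).
  apply: measurable_funM; first by apply: measurable_betatilde; distinct_sources.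
  apply: mPgD; try distinct_sources.
  by apply/eqP => -[] /eqP; rewrite (negbTE ji).
rewrite (mean_Phi_mul mc (C := beta0 M * (gamma0 M * (\sum_d `|dj d|) * alpha_Phi M)) (g := id))//.
- by rewrite mean_Phi// mulr0.
- by move=> w; rewrite normrM ler_pM//; exact: bounded_betatilde.
- exact: has_mean_Phi.
Qed.

Let remainder (w : Omega M) : R :=
  G M (activity k w) (performed k a w) - G M (activity k w) a -
  \sum_j gammatilde j k w * Phi j k w * D j w.

(** The Hessian is bounded in the directions of active nodes only, and the
    displacement of an inactive node is 0. *)
Lemma remainder_le (w : Omega M) : `|remainder w| <=
  alpha_G M * alpha_Phi M ^+ 2 / 2 *
    \sum_j1 \sum_j2 gammatilde j1 k w * gammatilde j2 k w.
Proof.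
have aG0 := alpha_G_gt0 hutil; have aP0 := alpha_Phi_gt0 hsrc.
pose h : 'rV[R]_N := \row_j (gammatilde j k w * Phi j k w).
have hE j : h 0 j = gammatilde j k w * Phi j k w by rewrite mxE.
have := @taylor2_box R N (dmin M) (dmax M) (G M (activity k w)) a h
  (alpha_G M * alpha_Phi M ^+ 2 *
    \sum_j1 \sum_j2 gammatilde j1 k w * gammatilde j2 k w).
move=> /(_ (G_twice_diff hutil _) ba (ha w)) T.
rewrite /remainder; under eq_bigr do rewrite -hE.
rewrite mulrAC; apply: T => x bx; apply: le_trans (ler_norm_sum _ _ _) _.
rewrite mulr_sumr; apply: ler_sum => i _; apply: le_trans (ler_norm_sum _ _ _) _.
rewrite mulr_sumr; apply: ler_sum => j _; rewrite !hE.
have g_ge0 l : 0 <= gammatilde l k w by have /andP[] := gammatilde_range hstep l k w.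
have [di|di] := boolP (delta i k w); last first.
  by rewrite !gammatildeE (negbTE di) !(mul0r, mulr0) normr0.
have [dj|dj] := boolP (delta j k w); last first.
  by rewrite !gammatildeE (negbTE dj) !(mul0r, mulr0) normr0.
have Gij : `|partial j (partial i (G M (activity k w))) x| <= alpha_G M.
  by apply: (G_hessian_bound hutil) => //; rewrite ffunE.
have Pi := Phi_abs hsrc n i w; have Pj := Phi_abs hsrc n j w.
move: (gammatilde i k w) (gammatilde j k w) (g_ge0 i) (g_ge0 j) => gi gj gi0 gj0.
rewrite !normrM (ger0_norm gi0) (ger0_norm gj0).
have -> : alpha_G M * alpha_Phi M ^+ 2 * (gi * gj) =
  gi * alpha_Phi M * (gj * alpha_Phi M) * alpha_G M by ring.
by rewrite !ler_pM ?mulr_ge0.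
Qed.

Let cubic i (j1 j2 : 'I_N) (w : Omega M) :=
  betatilde i k w * gammatilde j1 k w * gammatilde j2 k w.

Lemma cubic_range i j1 j2 (w : Omega M) :
  0 <= cubic i j1 j2 w <= beta0 M * gamma0 M * gamma0 M.
Proof.
rewrite /cubic.
move: (betatilde i k w) (gammatilde j1 k w) (gammatilde j2 k w)
  (betatilde_range hstep i k w) (gammatilde_range hstep j1 k w)
  (gammatilde_range hstep j2 k w) => b g h /andP[b0 b1] /andP[g0 g1] /andP[h0 h1].
by rewrite !mulr_ge0//= !ler_pM ?mulr_ge0.
Qed.

Lemma has_mean_cubic i j1 j2 : has_mean P (cubic i j1 j2).
Proof.
apply: (has_mean_bounded P (c := beta0 M * gamma0 M * gamma0 M)).
  apply: (others_measurableW hsrc (x := (Environment _, n))).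
  apply: measurable_funM; [apply: measurable_funM|];
    [apply: measurable_betatilde|apply: measurable_gammatilde|apply: measurable_gammatilde];
    distinct_sources.
by move=> w; have /andP[c0 c1] := cubic_range i j1 j2 w; rewrite ger0_norm.
Qed.

Lemma weightE i : weight M i k =
  qa M / betagamma M i k * \sum_j1 \sum_j2 \int[P]_w cubic i j1 j2 w.
Proof.
rewrite /weight; congr (_ * _); apply: eq_bigr => j1 _; apply: eq_bigr => j2 _.
exact: fine_expectation.
Qed.

Lemma gbar_expansion i : exists2 r, gbar M i k a =
  sigma_Phi M ^+ 2 * mean_step n i * partial i (F M) a + r &
  `|r| <= alpha_G M * alpha_Phi M ^+ 3 / 2 *
    \sum_j1 \sum_j2 \int[P]_w cubic i j1 j2 w.
Proof.
have [sG ->] := gbar_G hsrc hutil hstep ha i.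
have [sV V0] := mean_value_term i.
have sD j := (mean_gradient_term i j).1; have ED j := (mean_gradient_term i j).2.
have sS : has_mean P (fun w => \sum_j bPhi i w * (gammatilde j k w * Phi j k w * D j w)).
  by apply: has_mean_sum => j; exact: sD.
have rE w : bPhi i w * remainder w = bPhi i w * G M (activity k w) (performed k a w)
    - bPhi i w * G M (activity k w) a
    - \sum_j bPhi i w * (gammatilde j k w * Phi j k w * D j w).
  by rewrite /remainder !mulrBr mulr_sumr.
have sr : has_mean P (fun w => bPhi i w * remainder w).
  by under eq_fun do rewrite rE; apply: has_meanB => //; exact: has_meanB.
exists (\int[P]_w (bPhi i w * remainder w)).
  under [X in _ = _ + X]eq_Rintegral do rewrite rE.
  rewrite RintegralB//; last exact: has_meanB.
  rewrite RintegralB// V0 subr0 (mean_sum _ _ sD).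
  rewrite (eq_bigr _ (fun j _ => ED j)) -big_mkcond big_pred1_eq.
  by rewrite addrC subrK.
have -> : alpha_G M * alpha_Phi M ^+ 3 / 2 *
    \sum_j1 \sum_j2 \int[P]_w cubic i j1 j2 w =
  \int[P]_w (alpha_G M * alpha_Phi M ^+ 3 / 2 * \sum_j1 \sum_j2 cubic i j1 j2 w).
  have sc j1 : has_mean P (fun w => \sum_j2 cubic i j1 j2 w).
    by apply: has_mean_sum => j2; exact: has_mean_cubic.
  rewrite RintegralZl//; last by apply: has_mean_sum.
  rewrite mean_sum//; congr (_ * _); apply: eq_bigr => j1 _.
  by rewrite mean_sum// => j2; exact: has_mean_cubic.
apply: mean_norm_le => //.
  apply: has_meanZ; apply: has_mean_sum => j1; apply: has_mean_sum => j2.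
  exact: has_mean_cubic.
move=> w; rewrite normrM normrM.
have /andP[b0 b1] := betatilde_range hstep i k w; rewrite (ger0_norm b0).
apply: (@le_trans _ _ (betatilde i k w * alpha_Phi M * (alpha_G M * alpha_Phi M ^+ 2 / 2 *
    \sum_j1 \sum_j2 gammatilde j1 k w * gammatilde j2 k w))).
  apply: ler_pM => //; first by rewrite mulr_ge0.
    by apply: ler_wpM2l => //; exact: Phi_abs.
  exact: remainder_le.
have -> : \sum_j1 \sum_j2 cubic i j1 j2 w =
    betatilde i k w * \sum_j1 \sum_j2 gammatilde j1 k w * gammatilde j2 k w.
  rewrite mulr_sumr; apply: eq_bigr => j1 _; rewrite mulr_sumr.
  by apply: eq_bigr => j2 _; rewrite mulrA.
by set X := \sum_j1 _; rewrite le_eqVlt; apply/orP; left; apply/eqP; ring.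
Qed.

End point.
End bias_bound.

(** * Size of the weights and of the bias *)

Section weights.
Context (R : realType) (N : nat) (M : dosp_model R N).
Hypotheses (hsrc : random_sources M) (hstep : step_parameters M).
Local Notation P := (Pr M).

Section slot.
Variable n : nat.
Local Notation k := n.+1.

Lemma elltilde_binomial i m :
  P [set w | elltilde i k w = m] = (binomial_pmf n (qa M) m)%:E.
Proof. by rewrite (elltilde_law hsrc). Qed.

(** The counter of an active node is at most [k] almost surely, and the steps
    decrease. *)
Lemma mean_step_ge i :
  beta0 M * gamma0 M * k%:R `^ (- (c1 M + c2 M)) <= mean_step M n i.
Proof.
have [b0 g0 /andP[c11 c12] /andP[c20 c21] _] := hstep.
rewrite /mean_step (mean_binomial (measurable_elltilde_slot hsrc n i)
  (elltilde_binomial i) (step_product_bound hstep)).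
rewrite -[leLHS]mulr1 -[X in _ * X <= _](binomial_pmf_sum n (qa M)) mulr_sumr.
apply: ler_sum => m _; apply: ler_wpM2r.
  by apply: binomial_pmf_ge0; have /andP[q0 ->] := qa_range hsrc; rewrite ltW.
rewrite /beta /gamma mulrACA; apply: ler_wpM2l; first by rewrite mulr_ge0// ltW.
have m0 : (0 : R) < m.+1%:R by rewrite ltr0n.
rewrite -powRD ?(gt_eqF m0) ?implybT// -opprD !powRN.
rewrite lef_pV2 ?posrE ?powR_gt0 ?ltr0n//.
have mk : (m.+1%:R : R) <= k%:R by rewrite ler_nat.
have cc0 : 0 <= c1 M + c2 M by lra.
by apply: ge0_ler_powR; rewrite ?nnegrE ?ler0n.
Qed.

Lemma mean_step_gt0 i : 0 < mean_step M n i.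
Proof.
apply: lt_le_trans (mean_step_ge i).
by rewrite !mulr_gt0 ?powR_gt0 ?ltr0n ?(beta0_gt0 hstep) ?(gamma0_gt0 hstep).
Qed.

Lemma has_mean_inverse_square i :
  has_mean P (fun w => (k%:R / (elltilde i k w).+1%:R) ^+ 2).
Proof.
apply: (has_mean_bounded P (c := k%:R ^+ 2)).
  by apply: (measurableT_comp (f := fun m : nat => (k%:R / m.+1%:R : R) ^+ 2));
    last exact: measurable_elltilde_slot.
move=> w; rewrite ger0_norm ?sqr_ge0// lerXn2r ?nnegrE ?divr_ge0//.
by rewrite ler_pdivrMr ?ltr0n// ler_peMr// ler1n.
Qed.

Lemma exponents_range : [/\ 0 <= c1 M, 0 <= c2 M & c1 M + 2 * c2 M <= 2].
Proof.
have [_ _ c1r c2r _] := hstep; move: (c1 M) (c2 M) c1r c2r => c c'.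
by move=> /andP[? ?] /andP[? ?]; split; lra.
Qed.

(** The indices may coincide or not, so the factors need not be independent; the
    pointwise bound [powR_prod3_le] treats all cases at once.  It applies because
    [c1 + 2 c2 <= 2 - c1]. *)
Lemma cubic_le i j1 j2 (w : Omega M) :
  betatilde i k w * gammatilde j1 k w * gammatilde j2 k w <=
  beta0 M * gamma0 M ^+ 2 * k%:R `^ (- (c1 M + 2 * c2 M)) *
    (1 + (k%:R / (elltilde i k w).+1%:R) ^+ 2
       + (k%:R / (elltilde j1 k w).+1%:R) ^+ 2
       + (k%:R / (elltilde j2 k w).+1%:R) ^+ 2).
Proof.
have [e1 e2 e3] := exponents_range.
have b0 := ltW (beta0_gt0 hstep); have g0 := ltW (gamma0_gt0 hstep).
have k1 : (1 : R) <= k%:R by rewrite ler1n.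
have pos (m : nat) : (0 : R) < m.+1%:R by rewrite ltr0n.
rewrite -[leRHS]mulrA.
have bg0 : 0 <= beta0 M * gamma0 M ^+ 2 by rewrite mulr_ge0 ?sqr_ge0.
apply: le_trans (ler_wpM2l bg0 (powR_prod3_le k1 (pos _) (pos _) (pos _) e1 e2 e3)).
rewrite betatildeE !gammatildeE /beta /gamma.
have le1 (b : bool) (y : R) : 0 <= y -> 0 <= b%:R * y <= y.
  by case: b; rewrite ?mul1r ?mul0r lexx// andbT.
set x := (elltilde i k w).+1%:R `^ _; set y := (elltilde j1 k w).+1%:R `^ _.
set z := (elltilde j2 k w).+1%:R `^ _.
have x0 : 0 <= x by exact: powR_ge0.
have y0 : 0 <= y by exact: powR_ge0.
have z0 : 0 <= z by exact: powR_ge0.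
clearbody x y z.
have /andP[h1 h2] := le1 (delta i k w) _ (mulr_ge0 b0 x0).
have /andP[h3 h4] := le1 (delta j1 k w) _ (mulr_ge0 g0 y0).
have /andP[h5 h6] := le1 (delta j2 k w) _ (mulr_ge0 g0 z0).
apply: (@le_trans _ _ (beta0 M * x * (gamma0 M * y) * (gamma0 M * z))).
  apply: (ler_pM _ h5 _ h6); first exact: (mulr_ge0 h1 h3).
  exact: (ler_pM h1 h3 h2 h4).
by rewrite le_eqVlt; apply/orP; left; apply/eqP; ring.
Qed.

Lemma cubic_mean_le i j1 j2 :
  \int[P]_w (betatilde i k w * gammatilde j1 k w * gammatilde j2 k w) <=
  beta0 M * gamma0 M ^+ 2 * k%:R `^ (- (c1 M + 2 * c2 M)) * (1 + 6 / qa M ^+ 2).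
Proof.
have b0 := ltW (beta0_gt0 hstep).
pose X j (w : Omega M) : R := (k%:R / (elltilde j k w).+1%:R) ^+ 2.
pose K : R := beta0 M * gamma0 M ^+ 2 * k%:R `^ (- (c1 M + 2 * c2 M)).
have K0 : 0 <= K by apply: mulr_ge0; [rewrite mulr_ge0 ?sqr_ge0|exact: powR_ge0].
have sX j : has_mean P (X j) by exact: has_mean_inverse_square.
have EX j : \int[P]_w X j w <= 2 / qa M ^+ 2.
  exact: (mean_binomial_inverse_square (measurable_elltilde_slot hsrc n j)
    (qa_range hsrc) (elltilde_binomial j)).
have s1 := has_mean_cst P (1 : R).
have s2 := has_meanD s1 (sX i); have s3 := has_meanD s2 (sX j1).
have s4 := has_meanD s3 (sX j2).
apply: (@le_trans _ _ (\int[P]_w (K * (1 + X i w + X j1 w + X j2 w)))).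
  apply: le_Rintegral => //; [exact: has_mean_cubic|exact: has_meanZ|].
  by move=> w _; exact: cubic_le.
rewrite RintegralZl// (RintegralD _ s3 (sX j2))// (RintegralD _ s2 (sX j1))//.
rewrite (RintegralD _ s1 (sX i))// mean_cst -/K; apply: ler_wpM2l => //.
have -> : 6 / qa M ^+ 2 = 2 / qa M ^+ 2 + 2 / qa M ^+ 2 + 2 / qa M ^+ 2.
  by ring.
by rewrite !addrA !lerD.
Qed.

Lemma weight_ratio i : weight M i k = (mean_step M n i)^-1 *
  \sum_j1 \sum_j2
    \int[P]_w (betatilde i k w * gammatilde j1 k w * gammatilde j2 k w).
Proof.
rewrite weightE betagammaE//; congr (_ * _).
have /andP[q0 _] := qa_range hsrc.
by rewrite invfM mulrA divff ?gt_eqF// mul1r.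
Qed.

Lemma weight_ge0 i : 0 <= weight M i k.
Proof.
rewrite weight_ratio mulr_ge0 ?invr_ge0 ?(ltW (mean_step_gt0 i))//.
apply: sumr_ge0 => j1 _; apply: sumr_ge0 => j2 _; apply: Rintegral_ge0 => w _.
by have /andP[] := cubic_range hstep n i j1 j2 w.
Qed.

(** The powers [k ^ -(c1 + 2 c2)] of the numerator and [k ^ -(c1 + c2)] of the
    denominator leave [k ^ -c2]. *)
Lemma weight_le i : weight M i k <=
  (N * N)%:R * gamma0 M * (1 + 6 / qa M ^+ 2) * k%:R `^ (- c2 M).
Proof.
have [b0 g0 /andP[c11 c12] /andP[c20 c21] _] := hstep.
pose A : R := beta0 M * gamma0 M * k%:R `^ (- (c1 M + c2 M)).
have k0 : (0 : R) < k%:R by rewrite ltr0n.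
have A0 : 0 < A by rewrite !mulr_gt0 ?powR_gt0.
rewrite weight_ratio.
apply: (@le_trans _ _ (A^-1 * ((N * N)%:R * (beta0 M * gamma0 M ^+ 2 *
    k%:R `^ (- (c1 M + 2 * c2 M)) * (1 + 6 / qa M ^+ 2))))).
  apply: ler_pM.
  - by rewrite invr_ge0 ltW// mean_step_gt0.
  - apply: sumr_ge0 => j1 _; apply: sumr_ge0 => j2 _; apply: Rintegral_ge0 => w _.
    by have /andP[] := cubic_range hstep n i j1 j2 w.
  - by rewrite lef_pV2 ?posrE ?mean_step_gt0// mean_step_ge.
  - set C := _ * (1 + _).
    apply: (@le_trans _ _ (\sum_(j1 < N) \sum_(j2 < N) C)).
      by apply: ler_sum => j1 _; apply: ler_sum => j2 _; exact: cubic_mean_le.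
    by rewrite !sumr_const !card_ord -mulrnA mulr_natl.
have -> : - (c1 M + 2 * c2 M) = - (c1 M + c2 M) + - c2 M by ring.
rewrite powRD ?(gt_eqF k0) ?implybT//.
have x0 : k%:R `^ (- (c1 M + c2 M)) != 0 :> R by rewrite gt_eqF// powR_gt0.
rewrite /A le_eqVlt; apply/orP; left; apply/eqP.
have q0 : qa M != 0 by rewrite gt_eqF//; have /andP[] := qa_range hsrc.
move: (k%:R `^ (- (c1 M + c2 M))) x0 (k%:R `^ (- c2 M)) => x x0 y.
by field; rewrite q0 x0 !gt_eqF.
Qed.

End slot.

Lemma weight_cvg0 i : weight M i k @[k --> \oo] --> (0 : R).
Proof.
have [_ _ _ /andP[c20 _] _] := hstep.
pose C : R := (N * N)%:R * gamma0 M * (1 + 6 / qa M ^+ 2).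
have bounds k : (0 < k)%N -> 0 <= weight M i k <= C * (k%:R : R) `^ (- c2 M).
  by case: k => // n _; rewrite weight_ge0 weight_le.
have h : C * (k%:R : R) `^ (- c2 M) @[k --> \oo] --> (0 : R).
  rewrite -[X in _ --> X](mulr0 C); apply: cvgM; first exact: cvg_cst.
  exact: cvg_natr_powRN.
apply: (squeeze_cvgr _ (cvg_cst 0) h); near=> k.
by apply: bounds; near: k; exists 1%N.
Unshelve. all: by end_near. Qed.

End weights.

Section bias.
Context (R : realType) (N : nat) (M : dosp_model R N).
Hypotheses (hsrc : random_sources M) (hutil : regular_utilities M).
Hypothesis hstep : step_parameters M.

(** Exactly the gradient is cancelled, and the bias is the normalized Taylor
    remainder. *)
Lemma bias_le i k (a : 'rV[R]_N) : (0 < k)%N -> performable M k a ->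
  `|bias M i k a| <=
    alpha_G M * alpha_Phi M ^+ 3 / (2 * sigma_Phi M ^+ 2) * weight M i k.
Proof.
case: k => // n _ ha.
have [r rE rle] := gbar_expansion hsrc hutil hstep ha i.
have m0 := mean_step_gt0 hsrc hstep n i.
have s0 := sigma_Phi_gt0 hsrc.
have /andP[q0 _] := qa_range hsrc.
have -> : bias M i n.+1 a = r / (sigma_Phi M ^+ 2 * mean_step M n i).
  rewrite /bias rE betagammaE//; field.
  by rewrite !gt_eqF.
have d0 : 0 < sigma_Phi M ^+ 2 * mean_step M n i by rewrite mulr_gt0 ?exprn_gt0.
rewrite normrM normfV (gtr0_norm d0) ler_pdivrMr//; apply: le_trans rle _.
rewrite (weight_ratio hsrc hstep); set S := \sum_j1 _.
rewrite le_eqVlt; apply/orP; left; apply/eqP; field.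
by rewrite !gt_eqF.
Qed.

(** Performability is what arbitrary actions and the iterates of the algorithm
    have in common: while the perturbation steps are larger than the action
    intervals, the projection may push an iterate out of
    [box (amin M) (amax M)]. *)
Lemma bias_cvg0 i (a : nat -> 'rV[R]_N) :
  (forall k, (0 < k)%N -> performable M k (a k)) ->
  `|bias M i k (a k)| @[k --> \oo] --> (0 : R).
Proof.
move=> ha; pose C := alpha_G M * alpha_Phi M ^+ 3 / (2 * sigma_Phi M ^+ 2).
have h : C * weight M i k @[k --> \oo] --> (0 : R).
  by rewrite -[X in _ --> X](mulr0 C); apply: cvgM; [exact: cvg_cst|exact: weight_cvg0].
apply: (squeeze_cvgr _ (cvg_cst 0) h); near=> k.
have k0 : (0 < k)%N by near: k; exists 1%N.
by rewrite normr_ge0 bias_le//; exact: ha.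
Unshelve. all: by end_near. Qed.

End bias.

Theorem theorem1 (R : realType) (N : nat) (M : dosp_model R N)
    (act : nat -> Omega M -> 'rV[R]_N)
    (hsrc : random_sources M) (hutil : regular_utilities M)
    (hstep : step_parameters M) (halg : dosp_s act) :
  (forall (i : 'I_N) (k : nat) (a : 'rV[R]_N),
     (0 < k)%N -> box (amin M) (amax M) a -> performable M k a ->
     `|bias M i k a|
       <= alpha_G M * alpha_Phi M ^+ 3 / (2 * sigma_Phi M ^+ 2) * weight M i k)
  /\ (forall i : 'I_N, weight M i k @[k --> \oo] --> (0 : R))
  /\ (forall (i : 'I_N) (a : nat -> 'rV[R]_N),
        (forall k, (0 < k)%N ->
           box (amin M) (amax M) (a k) /\ performable M k (a k)) ->
        `|bias M i k (a k)| @[k --> \oo] --> (0 : R))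
  /\ (forall (i : 'I_N) (w : Omega M),
        (forall k, (0 < k)%N -> performable M k (act k w)) ->
        `|bias M i k (act k w)| @[k --> \oo] --> (0 : R)).
Proof.
split; first by move=> i k a k0 _; exact: bias_le.
split; first by move=> i; exact: weight_cvg0.
split=> [i a ha|i w hw].
  by apply: bias_cvg0 => // k k0; have [] := ha k k0.
exact: (bias_cvg0 hsrc hutil hstep i (a := fun k => act k w)).
Qed.
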